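(* Let $d,n$ be positive integers. Let $H$ be an abelian subgroup of the $n$-qudit Pauli group $\mathcal{P}^{(d)}_n$ without non-trivial scalars (i.e. $H\cap\{\zeta^a : a\in\mathbb{Z}\}=\{I\}$). Then the group $N(H)/H$ is isomorphic to $\mathcal{P}^{(d)}_{n-k}$ for some $k$ (with $0\le k\le n$) if and only if $H$ is shifted free. Moreover, in this case the action of $N(H)/H$ on $V^H$ can be identified with the action of $\mathcal{P}^{(d)}_{n-k}$ on $(\mathbb{C}^d)^{\otimes (n-k)}$, where the isomorphism $V^H\simeq (\mathbb{C}^d)^{\otimes (n-k)}$ is unitary.
   Context: Set $\bar d=d$ if $d$ is odd and $\bar d=2d$ if $d$ is even. Fix a primitive $\bar d$-th root of unity $\zeta\in\mathbb{C}$ and set $\xi=\zeta^2$, a primitive $d$-th root of unity. The space $\mathbb{C}^d$ has an orthonormal basis $\{v_i : i\in\mathbb{Z}/d\mathbb{Z}\}$ and operators $X(v_i)=v_{i+1}$, $Z(v_i)=\xi^i v_i$. Let $V=(\mathbb{C}^d)^{\otimes n}$ with the induced hermitian scalar product. For $r\in\{1,\dots,n\}$, $X_r$ and $Z_r$ denote the operators $X$ and $Z$ acting on the $r$-th tensor factor (identity on the others). The Pauli group $\mathcal{P}_n=\mathcal{P}_n^{(d)}\subset GL(V)$ is the subgroup generated by $X_r,Z_r$ ($1\leq r\leq n$) and by the operator of multiplication by $\zeta$ (also denoted $\zeta$); $\mathcal{P}_0^{(d)}$ is the group generated by the scalar $\zeta$ acting on $\mathbb{C}$. For a subgroup $H\subset\mathcal{P}_n$,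 $V^H=\{v\in V : h(v)=v\ \forall h\in H\}$, and $N(H)$ is the normaliser of $H$ in $\mathcal{P}_n$; $N(H)/H$ acts on $V^H$. Let $F_n$ be the free $\mathbb{Z}/d\mathbb{Z}$-module with basis $(z_1,\ldots,z_n,x_1,\ldots,x_n)$ and let $\phi$ be the alternating form on $F_n$ with $\phi(z_i,z_j)=\phi(x_i,x_j)=0$, $\phi(z_i,x_j)=-\phi(x_j,z_i)=\delta_{i,j}$. Let $\tau\colon\mathcal{P}_n\to F_n$ be the surjective group homomorphism with kernel $\langle\zeta\rangle$ given by $Z_r\mapsto z_r$, $X_r\mapsto x_r$. A symplectic basis of $F_n$ is a $\mathbb{Z}/d\mathbb{Z}$-basis $(e_1,\ldots,e_n,f_1,\ldots,f_n)$ with $\phi(e_i,e_j)=\phi(f_i,f_j)=0$, $\phi(e_i,f_j)=\delta_{i,j}$. Definition (shifted free). Let $H'\subset\mathcal{P}_n$ be an abelian subgroup with $H'\cap\{\zeta^a: a\in\mathbb{Z}\}=\{I\}$ and $H'\simeq(\mathbb{Z}/d\mathbb{Z})^k$. One can choose a symplectic basis $(e_1,\ldots,e_n,f_1,\ldots,f_n)$ of $F_n$ such that $(e_1,\ldots,e_k)$ is a basis of $\tau(H')$, and lifts $Z'_1,\ldots,Z'_n,X'_1,\ldots,X'_n\in\mathcal{P}_n$ of $e_1,\ldots,e_n,f_1,\ldots,f_n$ along $\tau$, all of order $d$ (so that they satisfy the same relations as the standard generators $Z_1,\dots,Z_n,X_1,\dots,X_n$ of $\mathcal{P}_n$), with $H'=\langle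 Z'_1,\ldots,Z'_k\rangle$. A group $H$ is a shift of $H'$ if, for some such choice of basis and lifts and some positive integers $a_1,\ldots,a_k$ dividing $d$, $$H=\langle {Z'_1}^{a_1},\ldots,{Z'_k}^{a_k},{X'_1}^{d/a_1},\ldots,{X'_k}^{d/a_k}\rangle.$$ A subgroup $H$ is shifted free if it is a shift of some such $H'$ (for some $k\in\{0,\dots,n\}$). *)

(* Defs.v *)
From HB Require Import structures.
From mathcomp Require Import all_boot all_order all_algebra all_fingroup.
From mathcomp Require Import ring boolp reals complex.

Set Implicit Arguments.
Unset Strict Implicit.
Unset Printing Implicit Defensive.

Import Order.TTheory GRing.Theory Num.Theory.
Local Open Scope ring_scope.

(* Z/dZ for every d > 0, including d = 1 (unlike 'Z_d, which is Z/2Z there);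
   the ring may be trivial, hence the Pz ("possibly zero") ring structure. *)
Definition Zmod (d : nat) := 'I_d.-1.+1.

HB.instance Definition _ d := FinRing.Zmodule.on (Zmod d).

Section ZmodRing.
Variable d : nat.
Let mul : Zmod d -> Zmod d -> Zmod d := @Zp_mul d.-1.+1.
Fact Zmod_mulA : associative mul. Proof. exact: Zp_mulA. Qed.
Fact Zmod_mulC : commutative mul. Proof. exact: Zp_mulC. Qed.
Fact Zmod_mul1 : left_id (Zp1 : Zmod d) mul. Proof. exact: Zp_mul1z. Qed.
Fact Zmod_mulD : left_distributive mul +%R. Proof. exact: Zp_mul_addl. Qed.

HB.instance Definition _ := GRing.Zmodule_isComPzRing.Build (Zmod d)
  Zmod_mulA Zmod_mulC Zmod_mul1 Zmod_mulD.
End ZmodRing.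

Section GL.
Variables (K : fieldType) (V : vectType K).

Definition GL := {f : 'End(V) | lker f == 0%VS}.
HB.instance Definition _ := SubChoice.on GL.
Implicit Types f g h : GL.

Fact GL_one_subproof : lker (\1%VF : 'End(V)) == 0%VS.
Proof. by apply/lker0P => u v; rewrite !id_lfunE. Qed.
Fact GL_mul_subproof f g : lker (val f \o val g)%VF == 0%VS.
Proof.
apply/lker0P => u v; rewrite !comp_lfunE.
by move/(lker0P (valP f))/(lker0P (valP g)).
Qed.
Fact GL_inv_subproof f : lker (val f)^-1%VF == 0%VS.
Proof.
have fK := lker0_compVf (valP f); have Kf := lker0_compfV (valP f).
apply/lker0P => u v /(congr1 (val f)).
by rewrite -!comp_lfunE Kf !id_lfunE.
Qed.

Definition GL_one : GL := Sub (\1%VF : 'End(V)) GL_one_subproof.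
Definition GL_mul f g : GL := Sub (val f \o val g)%VF (GL_mul_subproof f g).
Definition GL_inv f : GL := Sub ((val f)^-1)%VF (GL_inv_subproof f).

Fact GL_mulA : associative GL_mul.
Proof. by move=> f g h; apply: val_inj; rewrite /= comp_lfunA. Qed.
Fact GL_mul1 : left_id GL_one GL_mul.
Proof. by move=> f; apply: val_inj; rewrite /= comp_lfun1l. Qed.
Fact GL_1mul : right_id GL_one GL_mul.
Proof. by move=> f; apply: val_inj; rewrite /= comp_lfun1r. Qed.
Fact GL_mulV : left_inverse GL_one GL_inv GL_mul.
Proof. by move=> f; apply: val_inj; rewrite /= lker0_compVf // (valP f). Qed.
Fact GL_Vmul : right_inverse GL_one GL_inv GL_mul.
Proof. by move=> f; apply: val_inj; rewrite /= lker0_compfV // (valP f). Qed.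

HB.instance Definition _ :=
  isGroup.Build GL GL_mulA GL_mul1 GL_1mul GL_mulV GL_Vmul.

End GL.

Section Generated.
Variables (G : groupType) (S : G -> Prop).
Local Open Scope group_scope.

Inductive generated : G -> Prop :=
| gen_in x : S x -> generated x
| gen_one : generated 1
| gen_mul x y : generated x -> generated y -> generated (x * y)
| gen_inv x : generated x -> generated x^-1.

Definition gen_pred : {pred G} := fun x => `[< generated x >].

Fact gen_pred_closed : group_closed gen_pred.
Proof.
split; last by move=> x y /asboolP gx /asboolP gy;
  apply/asboolP; apply: gen_mul => //; exact: gen_inv.
by apply/asboolP; exact: gen_one.
Qed.

End Generated.

(* (C^d)^{\otimes n} as the space of functions on (Z/dZ)^n: the function
   [tensor_basis t] is v_{t_1} \otimes ... \otimes v_{t_n}. *)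
Notation qudits C d n := {ffun 'rV[Zmod d]_n -> C^o}.

Definition tensor_basis (C : numClosedFieldType) (d n : nat) (t : 'rV[Zmod d]_n) :
  qudits C d n := [ffun s => (s == t)%:R].

Definition hdot (C : numClosedFieldType) (d n : nat) (u v : qudits C d n) : C :=
  \sum_t u t * (v t)^*.

Section LinearExtension.
Variables (C : numClosedFieldType) (d n : nat).
Variable w : 'rV[Zmod d]_n -> qudits C d n.

Definition lin_ext_fun (v : qudits C d n) : qudits C d n := \sum_t (v t : C) *: w t.

Fact lin_ext_linear : linear lin_ext_fun.
Proof.
move=> a u v; rewrite /lin_ext_fun scaler_sumr -big_split /=.
by apply: eq_bigr => t _; rewrite !ffunE scalerDl scalerA.
Qed.

HB.instance Definition _ :=
  GRing.isLinear.Build C (qudits C d n) (qudits C d n) _ lin_ext_fun lin_ext_linear.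

Definition lin_ext : 'End(qudits C d n) := linfun lin_ext_fun.

Lemma lin_extE t : lin_ext (tensor_basis C t) = w t.
Proof.
rewrite lfunE /= /lin_ext_fun (bigD1 t) //= ffunE eqxx scale1r.
by rewrite big1 ?addr0 // => s /negPf ns; rewrite ffunE ns scale0r.
Qed.

Lemma qudits_ext (f g : 'End(qudits C d n)) :
  (forall t, f (tensor_basis C t) = g (tensor_basis C t)) -> f = g.
Proof.
move=> fg; apply/lfunP => v.
have -> : v = \sum_t (v t : C) *: tensor_basis C t.
  apply/ffunP => s; rewrite sum_ffunE (bigD1 s) //= !ffunE eqxx.
  rewrite big1 ?addr0; first by rewrite [RHS]mulr1.
  by move=> t nt; rewrite !ffunE eq_sym (negPf nt) [LHS]mulr0.
by rewrite !linear_sum; apply: eq_bigr => t _; rewrite !linearZ /= fg.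
Qed.

End LinearExtension.

Lemma hdot_basis (C : numClosedFieldType) (d n : nat) (s t : 'rV[Zmod d]_n) :
  hdot (tensor_basis C s) (tensor_basis C t) = (s == t)%:R.
Proof.
rewrite /hdot (bigD1 s) //= !ffunE eqxx mul1r conjC_nat.
by rewrite big1 ?addr0 // => u /negPf nu; rewrite ffunE nu mul0r.
Qed.

Definition dbar (d : nat) : nat := if odd d then d else d.*2.

Section Pauli.
Variables (C : numClosedFieldType) (d : nat) (zeta : C).
Hypothesis zetaP : (dbar d).-primitive_root zeta.
Variable n : nat.
Local Notation V := (qudits C d n).
Local Notation T := 'rV[Zmod d]_n.
Local Notation xi := (zeta ^+ 2).
Implicit Types (r : 'I_n) (s t a b : T).

Definition pauliX_fun r : 'End(V) :=
  lin_ext (fun t => tensor_basis C (t + delta_mx 0 r)).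
Definition pauliZ_fun r : 'End(V) :=
  lin_ext (fun t => xi ^+ (t 0 r : Zmod d) *: tensor_basis C t).
Definition scalar_fun : 'End(V) := zeta *: \1%VF.

(* [chi b t] is the eigenvalue of \prod_r Z_r ^ (b_r) at v_t. *)
Definition chi b t : C := \prod_r xi ^+ ((b 0%R r : Zmod d) * (t 0%R r : Zmod d))%N.

Lemma d_gt0 : (0 < d)%N.
Proof.
have /prim_order_gt0 := zetaP; rewrite /dbar.
by case: odd => //; rewrite double_gt0.
Qed.

Lemma zeta_neq0 : zeta != 0.
Proof.
apply/eqP => z0; have := prim_expr_order zetaP.
by rewrite z0 expr0n (gtn_eqF (prim_order_gt0 zetaP)) => /esym/eqP; rewrite oner_eq0.
Qed.

Lemma xi_prim : d.-primitive_root xi.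
Proof.
have := exp_prim_root zetaP 2; rewrite /dbar; case: ifP => [od|/negbT nod].
  have -> : gcdn 2 d = 1%N by apply/eqP; rewrite -/(coprime 2 d) coprime2n.
  by rewrite divn1.
by rewrite -muln2 (gcdn_idPl _) ?dvdn_mull // mulnK.
Qed.

Lemma card_Zmod : (d.-1.+1 = d)%N. Proof. exact: prednK d_gt0. Qed.

Lemma chi_neq0 b t : chi b t != 0.
Proof. by apply/prodf_neq0 => r _; rewrite !expf_neq0 ?zeta_neq0. Qed.

Lemma xi_mod k : xi ^+ (k %% d.-1.+1) = xi ^+ k.
Proof. by rewrite card_Zmod (prim_expr_mod xi_prim). Qed.

Lemma chiDr b s t : chi b (s + t) = chi b s * chi b t.
Proof.
rewrite /chi -big_split; apply: eq_bigr => r _ /=; rewrite mxE -exprD -mulnDr.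
by rewrite -xi_mod modnMmr xi_mod.
Qed.

Lemma chiC b t : chi b t = chi t b.
Proof. by apply: eq_bigr => r _; rewrite mulnC. Qed.

Lemma chiDl a b t : chi (a + b) t = chi a t * chi b t.
Proof. by rewrite !(chiC _ t) chiDr. Qed.

Lemma chi0 b : chi b 0 = 1.
Proof. by apply: big1 => r _; rewrite mxE muln0. Qed.

Lemma chi_dbar b t : chi b t ^+ dbar d = 1.
Proof.
rewrite -prodrXl big1 // => r _; rewrite -!exprM mulnC exprM.
by rewrite (prim_expr_order zetaP) expr1n.
Qed.

Lemma chi_delta b r : chi b (delta_mx 0 r) = xi ^+ (b 0 r : Zmod d).
Proof.
rewrite /chi (bigD1 r) //= mxE !eqxx /= -xi_mod modnMmr muln1 xi_mod.
by rewrite big1 ?mulr1 // => s /negPf ns; rewrite mxE ns andbF muln0.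
Qed.

Lemma monomial_inj (f : 'End(V)) (c : T -> C) a : (forall t, c t != 0) ->
    (forall t, f (tensor_basis C t) = c t *: tensor_basis C (t + a)) ->
  lker f == 0%VS.
Proof.
move=> nc fE.
pose g := lin_ext (fun t => (c (t - a))^-1 *: tensor_basis C (t - a)).
have gf : (g \o f)%VF = \1%VF.
  apply: qudits_ext => t; rewrite comp_lfunE fE linearZ /= lin_extE.
  by rewrite addrK id_lfunE scalerA divff ?scale1r.
by apply/lker0P; apply: (can_inj (g := g)) => v; rewrite -comp_lfunE gf id_lfunE.
Qed.

Fact pauliX_inj r : lker (pauliX_fun r) == 0%VS.
Proof.
apply: (@monomial_inj _ (fun=> 1) (delta_mx 0 r)) => t; first exact: oner_neq0.
by rewrite lin_extE scale1r.
Qed.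

Fact pauliZ_inj r : lker (pauliZ_fun r) == 0%VS.
Proof.
apply: (@monomial_inj _ (fun t => xi ^+ (t 0 r : Zmod d)) 0) => t.
  by rewrite !expf_neq0 ?zeta_neq0.
by rewrite lin_extE addr0.
Qed.

Fact scalar_inj : lker scalar_fun == 0%VS.
Proof.
apply: (@monomial_inj _ (fun=> zeta) 0) => t; first exact: zeta_neq0.
by rewrite scale_lfunE id_lfunE addr0.
Qed.

Definition GL_X r : GL V := Sub (pauliX_fun r) (pauliX_inj r).
Definition GL_Z r : GL V := Sub (pauliZ_fun r) (pauliZ_inj r).
Definition GL_zeta : GL V := Sub scalar_fun scalar_inj.

Definition pauli_gens (g : GL V) : Prop :=
  [\/ exists r, g = GL_X r, exists r, g = GL_Z r | g = GL_zeta].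

(* The subgroup of GL(V) generated by the X_r, the Z_r and zeta; the normal form
   zeta^c X^a Z^b obtained below shows that it is finite. *)
Definition pauli := {g : GL V | g \in gen_pred pauli_gens}.

HB.instance Definition _ := SubChoice.on pauli.
HB.instance Definition _ := SubChoice_isSubGroup.Build (GL V)
  (mem (gen_pred pauli_gens)) pauli (gen_pred_closed pauli_gens).
Implicit Types g h : pauli.

Definition pauli_op g : 'End(V) := val (val g).

Lemma pauli_opM g h : pauli_op (g * h)%g = (pauli_op g \o pauli_op h)%VF.
Proof. by []. Qed.
Lemma pauli_op1 : pauli_op 1%g = \1%VF.
Proof. by []. Qed.
Lemma pauli_op_inj : injective pauli_op.
Proof. by move=> g h /val_inj/val_inj. Qed.

(* The operator zeta^c X^a Z^b, with w = (c, b, a). *)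
Definition weyl_form (f : 'End(V)) (w : 'I_(dbar d) * T * T) : Prop :=
  forall t, f (tensor_basis C t) =
    (zeta ^+ w.1.1 * chi w.1.2 t) *: tensor_basis C (t + w.2).

Lemma weyl_formI (f : 'End(V)) (s : C) b a : s ^+ dbar d = 1 ->
    (forall t, f (tensor_basis C t) = (s * chi b t) *: tensor_basis C (t + a)) ->
  exists w, weyl_form f w.
Proof. by case/(prim_rootP zetaP) => i -> fE; exists (i, b, a). Qed.

Lemma zetaX_dbar k : (zeta ^+ k) ^+ dbar d = 1.
Proof. by rewrite exprAC (prim_expr_order zetaP) expr1n. Qed.

Lemma generated_weyl (x : GL V) :
  generated pauli_gens x -> exists w, weyl_form (val x) w.
Proof.
elim=> {x} [x|//|x y _ [w xE] _ [w' yE]|x _ [[[c b] a] xE]].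
- case=> [[r ->]|[r ->]|->].
  + apply: (@weyl_formI _ 1 0 (delta_mx 0 r)); first by rewrite expr1n.
    by move=> t; rewrite chiC chi0 mulr1 scale1r lin_extE.
  + apply: (@weyl_formI _ 1 (delta_mx 0 r) 0); first by rewrite expr1n.
    by move=> t; rewrite chiC chi_delta mul1r lin_extE addr0.
  + apply: (@weyl_formI _ zeta 0 0); first exact: prim_expr_order.
    by move=> t; rewrite chiC chi0 mulr1 scale_lfunE id_lfunE addr0.
- apply: (@weyl_formI _ 1 0 0); first by rewrite expr1n.
  by move=> t; rewrite chiC chi0 mulr1 scale1r id_lfunE addr0.
- apply: (@weyl_formI _ (zeta ^+ w.1.1 * zeta ^+ w'.1.1 * chi w.1.2 w'.2)
            (w.1.2 + w'.1.2) (w'.2 + w.2)).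
    by rewrite !exprMn !zetaX_dbar chi_dbar !mulr1.
  move=> t; rewrite comp_lfunE yE linearZ /= xE scalerA addrA.
  by congr (_ *: _); rewrite chiDr chiDl; ring.
- apply: (@weyl_formI _ (zeta ^- c * chi b a) (- b) (- a)).
    by rewrite exprMn exprVn zetaX_dbar chi_dbar invr1 mulr1.
  move=> t; apply: (lker0P (valP x)).
  rewrite -comp_lfunE lker0_compfV ?(valP x) // id_lfunE linearZ /= xE /=.
  rewrite addrNK scalerA -[LHS]scale1r; congr (_ *: _).
  rewrite chiDr (_ : chi b (- a) = (chi b a)^-1); last first.
    by apply: (mulfI (chi_neq0 b a)); rewrite -chiDr subrr chi0 divff ?chi_neq0.
  rewrite (_ : chi (- b) t = (chi b t)^-1); last first.
    by apply: (mulfI (chi_neq0 b t)); rewrite -chiDl subrr chiC chi0 divff ?chi_neq0.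
  have zc : zeta ^+ c != 0 by rewrite expf_neq0 ?zeta_neq0.
  have := chi_neq0 b a; have := chi_neq0 b t; move: zc.
  by move: (zeta ^+ c) (chi b a) (chi b t) => u v w *; field; apply/and3P.
Qed.

Lemma pauli_normal g : exists w, weyl_form (pauli_op g) w.
Proof. by case: g => x gx; apply/generated_weyl/asboolP. Qed.

Lemma tensor_basisZ_inj (c c' : C) s t : c != 0 ->
  c *: tensor_basis C s = c' *: tensor_basis C t -> s = t /\ c = c'.
Proof.
move=> nc /ffunP/(_ s); rewrite !ffunE eqxx [LHS]mulr1.
case: eqVneq => [<- ->|_]; first by rewrite [c' *: _]mulr1.
by rewrite [RHS]mulr0 => c0; rewrite c0 eqxx in nc.
Qed.

Lemma weyl_form_uniq (f : 'End(V)) w w' : weyl_form f w -> weyl_form f w' -> w = w'.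
Proof.
move: w w' => [[c b] a] [[c' b'] a'] fE fE'.
have eqw t : t + a = t + a' /\ zeta ^+ c * chi b t = zeta ^+ c' * chi b' t.
  apply: tensor_basisZ_inj; first by rewrite mulf_neq0 ?expf_neq0 ?zeta_neq0 ?chi_neq0.
  by rewrite -fE -fE'.
have [/addrI -> /eqP] := eqw 0; rewrite !chi0 !mulr1 => cc'.
have Ecc : c = c'.
  by apply/val_inj; move: cc'; rewrite (eq_prim_root_expr zetaP) !modn_small // => /eqP.
congr (_, _, _) => //; apply/rowP => r.
have [_] := eqw (delta_mx 0 r); rewrite Ecc !chi_delta.
move/(mulfI (expf_neq0 _ zeta_neq0))/eqP.
have ltd (i : Zmod d) : (i < d)%N by rewrite -{2}card_Zmod ltn_ord.
by rewrite (eq_prim_root_expr xi_prim) !modn_small // => /eqP/val_inj.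
Qed.

Definition normal_form g := projT1 (cid (pauli_normal g)).

Lemma normal_formP g : weyl_form (pauli_op g) (normal_form g).
Proof. by rewrite /normal_form; case: cid. Qed.

Lemma normal_form_inj : injective normal_form.
Proof.
move=> g h gh; apply/pauli_op_inj/qudits_ext => t.
by rewrite (normal_formP g) (normal_formP h) gh.
Qed.

Definition of_normal_form w : option pauli :=
  if pselect (exists g, normal_form g = w) is left ex then Some (projT1 (cid ex))
  else None.

Fact normal_formK : pcancel normal_form of_normal_form.
Proof.
move=> g; rewrite /of_normal_form; case: pselect => [ex|[]]; last by exists g.
by congr Some; apply: normal_form_inj; case: cid.
Qed.

HB.instance Definition _ := PCanIsCountable normal_formK.
HB.instance Definition _ : isFinite pauli := PCanIsFinite normal_formK.

Fact pauliX_gen r : GL_X r \in gen_pred pauli_gens.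
Proof. by apply/asboolP/gen_in/Or31; exists r. Qed.
Fact pauliZ_gen r : GL_Z r \in gen_pred pauli_gens.
Proof. by apply/asboolP/gen_in/Or32; exists r. Qed.
Fact pauli_zeta_gen : GL_zeta \in gen_pred pauli_gens.
Proof. exact/asboolP/gen_in/Or33. Qed.

Definition pauliX r : pauli := Sub (GL_X r) (pauliX_gen r).
Definition pauliZ r : pauli := Sub (GL_Z r) (pauliZ_gen r).
Definition pauli_zeta : pauli := Sub GL_zeta pauli_zeta_gen.

Lemma pauliXE r t :
  pauli_op (pauliX r) (tensor_basis C t) = tensor_basis C (t + delta_mx 0 r).
Proof. exact: lin_extE. Qed.

Lemma pauliZE r t :
  pauli_op (pauliZ r) (tensor_basis C t) =
  xi ^+ (t 0 r : Zmod d) *: tensor_basis C t.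
Proof. exact: lin_extE. Qed.

Lemma pauli_zetaE (v : V) : pauli_op pauli_zeta v = (zeta : C) *: v.
Proof. by rewrite [LHS]scale_lfunE id_lfunE. Qed.

(* F_n is the module of row vectors with coordinates (z_1..z_n, x_1..x_n); the
   homomorphism P_n -> F_n reads off the exponents of zeta^c X^a Z^b. *)
Definition tau g : 'rV[Zmod d]_(n + n) :=
  row_mx (normal_form g).1.2 (normal_form g).2.

Lemma tau_weyl g w : weyl_form (pauli_op g) w -> tau g = row_mx w.1.2 w.2.
Proof. by move=> gE; rewrite /tau (weyl_form_uniq (normal_formP g) gE). Qed.

Lemma tau_weylI g (s : C) b a : s ^+ dbar d = 1 ->
    (forall t, pauli_op g (tensor_basis C t) =
       (s * chi b t) *: tensor_basis C (t + a)) ->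
  tau g = row_mx b a.
Proof.
by case/(prim_rootP zetaP) => i -> fE; rewrite (@tau_weyl g (i, b, a)).
Qed.

Lemma tauM g h : tau (g * h)%g = tau g + tau h.
Proof.
have gE := normal_formP g; have hE := normal_formP h.
rewrite /tau add_row_mx -/(tau _).
move: (normal_form g) (normal_form h) gE hE => w w' gE hE.
apply: (@tau_weylI _ (zeta ^+ w.1.1 * zeta ^+ w'.1.1 * chi w.1.2 w'.2)).
  by rewrite !exprMn !zetaX_dbar chi_dbar !mulr1.
move=> t; rewrite pauli_opM comp_lfunE hE linearZ /= gE scalerA addrA addrAC.
by congr (_ *: _); rewrite chiDr chiDl; ring.
Qed.

Lemma tauZ r : tau (pauliZ r) = row_mx (delta_mx 0 r) 0.
Proof.
apply: (@tau_weylI _ 1); first by rewrite expr1n.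
by move=> t; rewrite chiC chi_delta mul1r pauliZE addr0.
Qed.

Lemma tauX r : tau (pauliX r) = row_mx 0 (delta_mx 0 r).
Proof.
apply: (@tau_weylI _ 1); first by rewrite expr1n.
by move=> t; rewrite chiC chi0 mulr1 scale1r pauliXE.
Qed.

Lemma tau1 : tau 1%g = 0.
Proof. by apply: (@addrI _ (tau 1%g)); rewrite -tauM mulg1 addr0. Qed.

Lemma pauli_zetaX k : pauli_op (pauli_zeta ^+ k)%g = zeta ^+ k *: \1%VF.
Proof.
elim: k => [|k IHk]; first by rewrite scale1r.
apply/lfunP => v; rewrite expgS pauli_opM comp_lfunE IHk pauli_zetaE.
by rewrite !scale_lfunE scalerA exprS.
Qed.

Lemma tau_ker g : (tau g == 0) = (g \in <[pauli_zeta]>%g).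
Proof.
apply/eqP/cycleP => [g0|[k ->]].
  have := normal_formP g; move: g0; rewrite /tau -row_mx0.
  case: (normal_form g) => [[c b] a] /= /eq_row_mx[-> ->] gE.
  exists c; apply/pauli_op_inj/qudits_ext => t.
  by rewrite gE pauli_zetaX scale_lfunE id_lfunE /= chiC chi0 mulr1 addr0.
elim: k => [|k IHk]; first exact: tau1.
rewrite expgS tauM IHk addr0 -row_mx0; apply: (@tau_weylI _ zeta).
  exact: prim_expr_order.
by move=> t; rewrite chiC chi0 mulr1 addr0 pauli_zetaE.
Qed.

Lemma tau_surj u : exists g, tau g = u.
Proof.
pose P w := exists g, tau g = w.
have P0 : P 0 by exists 1%g; exact: tau1.
have PD w w' : P w -> P w' -> P (w + w').
  by move=> [g <-] [h <-]; exists (g * h)%g; exact: tauM.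
have PM w k : P w -> P (w *+ k).
  by move=> Pw; elim: k => // k IHk; rewrite mulrS; exact: PD.
have scal (c : Zmod d) m (w : 'rV[Zmod d]_m) : c *: w = w *+ c.
  apply/rowP => i; rewrite !mxE mulmxnE; apply/val_inj.
  by rewrite mulrC /= [X in _ = val X]Zp_mulrn.
rewrite [u]row_sum_delta; apply: (big_ind P) => // j _; rewrite scal; apply: PM.
case: (split_ordP j) => r ->.
  by exists (pauliZ r); rewrite tauZ delta_mx_lshift.
by exists (pauliX r); rewrite tauX delta_mx_rshift.
Qed.

End Pauli.

Section Symplectic.
Variables (d n : nat).
Local Notation F := 'rV[Zmod d]_(n + n).

Definition phi (u v : F) : Zmod d :=
  \sum_(r < n) (u 0 (lshift n r) * v 0 (rshift n r)
               - u 0 (rshift n r) * v 0 (lshift n r)).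

Definition is_basis (I : finType) (b : I -> F) (S : {set F}) : Prop :=
  S = [set \sum_i c i *: b i | c : {ffun I -> Zmod d}] /\
  injective (fun c : {ffun I -> Zmod d} => \sum_i c i *: b i).

Definition symplectic_basis (e f : 'I_n -> F) : Prop :=
  is_basis (fun s : 'I_n + 'I_n => match s with inl i => e i | inr i => f i end)
    [set: F] /\
  forall i j, [/\ phi (e i) (e j) = 0, phi (f i) (f j) = 0
                & phi (e i) (f j) = (i == j)%:R].

End Symplectic.

Section ShiftedFree.
Variables (C : numClosedFieldType) (d : nat) (zeta : C).
Hypothesis zetaP : (dbar d).-primitive_root zeta.
Variable n : nat.
Local Notation P := (pauli zetaP n).
Local Notation tau := (@tau C d zeta zetaP n).
Local Open Scope group_scope.

Definition scalar_free (H : {group P}) : Prop := H :&: <[pauli_zeta zetaP n]> = 1.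

(* The standard relations between the Z'_i and X'_i need no clause: their
   commutators are determined by phi on the images under tau, and their orders
   are prescribed. *)
Definition is_shift (k : nat) (le_kn : (k <= n)%N) (H' H : {group P}) : Prop :=
  let w := widen_ord le_kn in
  exists (e f : 'I_n -> 'rV[Zmod d]_(n + n)) (Z' X' : 'I_n -> P) (a : 'I_k -> nat),
  [/\ symplectic_basis e f /\ is_basis (e \o w) [set tau g | g in H'],
      forall i, [/\ tau (Z' i) = e i, tau (X' i) = f i, #[Z' i] = d & #[X' i] = d],
      H' :=: <<[set Z' (w i) | i : 'I_k]>>,
      forall i, (0 < a i)%N && (a i %| d)%N
    & H :=: <<[set Z' (w i) ^+ a i | i : 'I_k] :|:
              [set X' (w i) ^+ (d %/ a i) | i : 'I_k]>>].

Definition shifted_free (H : {group P}) : Prop :=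
  exists (k : nat) (le_kn : (k <= n)%N) (H' : {group P}),
  [/\ abelian H', scalar_free H', H' \isog [set: 'rV[Zmod d]_k]
    & is_shift le_kn H' H].

Definition fixV (H : {set P}) : {vspace qudits C d n} :=
  (\bigcap_(g in H) fixedSpace (pauli_op g))%VS.

Lemma fixVP (H : {set P}) v :
  reflect (forall g, g \in H -> pauli_op g v = v) (v \in fixV H).
Proof.
apply: (iffP idP) => [vH g gH|vH].
  by apply/fixedSpaceP; apply: subvP vH; exact: bigcapv_inf gH _.
rewrite memvE; apply/subv_bigcapP => g gH; rewrite -memvE.
exact/fixedSpaceP/vH.
Qed.

(* An element of N(H)/H acts through any representative ([quot_actE]); the
   projection onto V^H only serves to land in the subspace type. *)
Definition quot_act (H : {group P}) (x : coset_of H) (v : subvs_of (fixV H)) :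
    subvs_of (fixV H) :=
  vsproj (fixV H) (pauli_op (repr x) (vsval v)).

Lemma fixV_norm (H : {group P}) g v :
  g \in 'N(H) -> v \in fixV H -> pauli_op g v \in fixV H.
Proof.
move=> gN /fixVP vH; apply/fixVP => h hH.
rewrite -comp_lfunE -pauli_opM.
have -> : h * g = g * h ^ g by rewrite conjgE mulgA mulgA mulgV mul1g.
by rewrite pauli_opM comp_lfunE vH // memJ_norm.
Qed.

Lemma quot_actE (H : {group P}) g (v : subvs_of (fixV H)) :
  g \in 'N(H) -> vsval (quot_act (coset H g) v) = pauli_op g (vsval v).
Proof.
move=> gN; rewrite /quot_act.
have [h gh Hh] : exists2 h, repr (coset H g) = g * h & h \in H.
  have : repr (coset H g) \in coset H g by exact: mem_repr_coset.
  rewrite val_coset // norm_rlcoset // => /lcosetP[h hH ->]; by exists h.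
rewrite gh pauli_opM comp_lfunE.
have vH := subvsP v; have /fixVP -> // := vH.
by rewrite vsprojK // fixV_norm.
Qed.

End ShiftedFree.

Definition unitary_iso (C : numClosedFieldType) (d n m : nat)
    (W : {vspace qudits C d n}) (U : 'Hom(subvs_of W, qudits C d m)) : Prop :=
  bijective U /\ forall u v, hdot (U u) (U v) = hdot (vsval u) (vsval v).

(* Main.v *)
Require Import Defs.
From HB Require Import structures.
From mathcomp Require Import all_boot all_order all_algebra all_fingroup.
From mathcomp Require Import cyclic nilpotent abelian ring boolp reals complex.

(* [tau] turns commutation in the Pauli group into the form [phi]: the normaliser
   of [H] is its centraliser, i.e. the preimage of the orthogonal of [L = tau(H)],
   and [tau] is injective on [H].

   An isomorphism of [N(H) / H] with [P_(n-k)] maps the centre to the centre, hence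
   scales [phi] by a unit; pulling the standard generators back gives [n - k]
   hyperbolic pairs in the orthogonal of [L], and in the complement [W] of their
   span [L] is its own orthogonal. Hyperbolic pairs are then split off [W]: if [E]
   is the exponent of [L] in [W] and [a = d / E], there is [e] in [W] of order [d]
   with [a e] in [L]; for [f] in [W] with [phi e f = 1], the vector [(d / a) f] is
   orthogonal to [L], hence lies in [L].

   Conversely, let [v0] be a unit vector fixed by [H] and by the [Z'_j], [j > k];
   it exists because non-scalar Pauli operators have trace [0]. The vectors
   [X'^t v0] are orthonormal, and the resolution of the identity by the Weyl
   operators shows that they span [V^H]. In this basis the [Z'_j] and [X'_j] act as
   the standard generators of [P_(n-k)], and together with [H] and [zeta] they
   generate [N(H)]. *)

Set Implicit Arguments.
Unset Strict Implicit.
Unset Printing Implicit Defensive.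

Import Order.TTheory GRing.Theory FinRing.Theory Num.Theory.
Local Open Scope ring_scope.

(** * Symplectic families over Z/d *)

Section ZmodTheory.
Variables (d : nat) (d_gt0 : (0 < d)%N).
Implicit Types (c x y : Zmod d) (m : nat).

Lemma ltn_Zmod x : (x < d)%N.
Proof. by rewrite -{2}(prednK d_gt0) ltn_ord. Qed.

Lemma Zmod_nat m : (m%:R : Zmod d) = (m %% d)%N :> nat.
Proof.
elim: m => [|m IHm]; first by rewrite mod0n.
have -> : (m.+1%:R : Zmod d) = (m%:R + 1 :> Zmod d) by rewrite -addn1 natrD.
rewrite -[LHS]/(((m%:R : Zmod d) + (1 %% d.-1.+1)) %% d.-1.+1)%N.
by rewrite IHm prednK // modnDm addn1.
Qed.

Lemma addn_Zmod x y : (x + y)%R = ((x + y) %% d)%N :> nat.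
Proof. exact: (congr1 (modn (x + y)%N) (prednK d_gt0)). Qed.

Lemma natr_Zmod x : (x : nat)%:R = x.
Proof. by apply: val_inj; rewrite /= Zmod_nat modn_small ?ltn_Zmod. Qed.

Lemma Zmod_nat_eq0 m : ((m%:R : Zmod d) == 0) = (d %| m)%N.
Proof. by rewrite -val_eqE /= Zmod_nat. Qed.

Lemma mulrn_Zmod x : x *+ d = 0.
Proof.
by rewrite -mulr_natr; have /eqP -> : (d%:R : Zmod d) == 0; rewrite ?mulr0 // Zmod_nat_eq0.
Qed.

Lemma scale_Zmod p (u : 'rV[Zmod d]_p) c : c *: u = u *+ c.
Proof. by rewrite -{1}(natr_Zmod c) scaler_nat. Qed.

Lemma mulrn_row p (u : 'rV[Zmod d]_p) : u *+ d = 0.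
Proof. by apply/rowP => i; rewrite mulmxnE mulrn_Zmod mxE. Qed.

Lemma Zmod_torsion m x : (m %| d)%N -> x *+ m = 0 -> (d %/ m %| x)%N.
Proof.
move=> md /eqP; rewrite -(natr_Zmod x) -mulrnA Zmod_nat_eq0.
rewrite natr_Zmod -{1}(divnK md) dvdn_pmul2r //; exact: dvdn_gt0 md.
Qed.

(** Each coordinate, read as an integer, is a multiple of [d / m], so it can be divided exactly. *)
Lemma row_torsion p (u : 'rV[Zmod d]_p) m :
  (m %| d)%N -> u *+ m = 0 -> exists v, u = v *+ (d %/ m)%N.
Proof.
move=> md u0; exists (\row_i ((u 0%R i : Zmod d) %/ (d %/ m))%N%:R).
apply/rowP => i; rewrite mulmxnE mxE -mulrnA divnK ?natr_Zmod //.
by apply: Zmod_torsion => //; rewrite -mulmxnE u0 mxE.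
Qed.

End ZmodTheory.

(** * The form [phi] and its nondegeneracy *)

Section Phi.
Variables (d n : nat) (d_gt0 : (0 < d)%N).
Local Notation F := 'rV[Zmod d]_(n + n).
Implicit Types (x y z : F).

Lemma phiDl x y z : phi (x + y) z = phi x z + phi y z.
Proof. by rewrite /phi -big_split; apply: eq_bigr => r _; rewrite !mxE /=; ring. Qed.

Lemma phi_skew x y : phi x y = - phi y x.
Proof. by rewrite /phi -sumrN; apply: eq_bigr => r _; ring. Qed.

Lemma phiDr x y z : phi x (y + z) = phi x y + phi x z.
Proof. by rewrite ![phi x _]phi_skew phiDl opprD. Qed.

Lemma phi_alt x : phi x x = 0.
Proof. by rewrite /phi big1 // => r _; rewrite mulrC subrr. Qed.

Lemma phiZl c x y : phi (c *: x) y = c * phi x y.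
Proof. by rewrite /phi mulr_sumr; apply: eq_bigr => r _; rewrite !mxE /=; ring. Qed.

Lemma phiZr c x y : phi x (c *: y) = c * phi x y.
Proof. by rewrite phi_skew phiZl [phi y x]phi_skew mulrN opprK. Qed.

Lemma phi0l y : phi 0 y = 0.
Proof. by rewrite -(scale0r (0 : F)) phiZl mul0r. Qed.

Lemma phi0r y : phi y 0 = 0.
Proof. by rewrite phi_skew phi0l oppr0. Qed.

Lemma phiNl x y : phi (- x) y = - phi x y.
Proof. by rewrite -scaleN1r phiZl mulN1r. Qed.

Lemma phiNr x y : phi x (- y) = - phi x y.
Proof. by rewrite -scaleN1r phiZr mulN1r. Qed.

Lemma phiMnl x y m : phi (x *+ m) y = phi x y *+ m.
Proof. by rewrite -scaler_nat phiZl mulr_natl. Qed.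

Lemma phiMnr x y m : phi x (y *+ m) = phi x y *+ m.
Proof. by rewrite -scaler_nat phiZr mulr_natl. Qed.

Lemma phi_suml (I : finType) (P : pred I) (G : I -> F) y :
  phi (\sum_(i | P i) G i) y = \sum_(i | P i) phi (G i) y.
Proof. exact: (big_morph (fun u => phi u y) (fun u v => phiDl u v y) (phi0l y)). Qed.

Lemma phi_zl x r : phi (row_mx (delta_mx 0 r) 0) x = x 0 (rshift n r).
Proof.
rewrite /phi (bigD1 r) //= !row_mxEl !row_mxEr !mxE !eqxx mul1r mul0r subr0.
by rewrite big1 ?addr0 // => s /negPf ns; rewrite !row_mxEl !row_mxEr !mxE ns andbF !mul0r subrr.
Qed.

Lemma phi_xl x r : phi (row_mx 0 (delta_mx 0 r)) x = - x 0 (lshift n r).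
Proof.
rewrite /phi (bigD1 r) //= !row_mxEl !row_mxEr !mxE !eqxx mul1r mul0r sub0r.
by rewrite big1 ?addr0 // => s /negPf ns; rewrite !row_mxEl !row_mxEr !mxE ns andbF !mul0r subrr.
Qed.

(** Pairing with the standard generators reads off the coordinates up to sign; commutation with the
    generators of a Pauli group provides exactly these products. *)
Lemma phi_nondeg_std x :
    (forall r, phi (row_mx (delta_mx 0 r) 0) x = 0) ->
    (forall r, phi (row_mx 0 (delta_mx 0 r)) x = 0) -> x = 0.
Proof.
move=> xz xx; apply/rowP => i; rewrite [RHS]mxE; case: (split_ordP i) => r ->.
  by apply: oppr_inj; rewrite oppr0 -phi_xl xx.
by rewrite -phi_zl xz.
Qed.

Lemma phi_nondeg x : (forall y, phi x y = 0) -> x = 0.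
Proof. by move=> x0; apply: phi_nondeg_std => r; rewrite phi_skew x0 oppr0. Qed.

End Phi.

(* The element has the largest order modulo [L]: lift an element of [A / L]
   whose order is the exponent. *)
Lemma exponent_witness_mod (gT : finGroupType) (A L : {group gT}) :
    abelian [set: gT] ->
  exists2 x, x \in A & forall m, (x ^+ m \in L -> forall y, y \in A -> y ^+ m \in L)%g.
Proof.
move=> abT; have nL (B : {group gT}) : B \subset 'N(L)%g.
  by apply/cents_norm/(sub_abelian_cent2 abT); rewrite subsetT.
have abQ : abelian (A / L)%g by rewrite quotient_abelian // (abelianS (subsetT A)).
have [_ /morphimP[x Nx Ax ->] ex] := exponent_witness (abelian_nil abQ).
exists x => // m xL y Ay; have Ny := subsetP (nL A) y Ay.
have mem z : z \in 'N(L)%g -> (z ^+ m \in L)%g = (coset L z ^+ m == 1)%g.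
  move=> Nz; rewrite -morphX // -[(_ == _)]/(coset L (z ^+ m)%g == 1%g).
  by apply/idP/eqP => [/coset_id//|/coset_idr]; apply; rewrite groupX.
have xm : (#[(coset L x)]%g %| m)%N by rewrite order_dvdn -mem.
by rewrite mem // -order_dvdn (dvdn_trans _ xm) // -ex dvdn_exponent ?mem_quotient.
Qed.
(** Multiplication by [c] identifies [Z/N] with [c Z/d]: congruences modulo [N] become equations in
    [Z/d], where [phi] takes its values. *)
Lemma Zmod_reduction d N c (x y : Zmod d) : (0 < d)%N -> (N * c = d)%N ->
  ((x : nat)%:R == (y : nat)%:R :> Zmod N) = (x *+ c == y *+ c).
Proof.
move=> d_gt0 Nc; have N_gt0 : (0 < N)%N by move: d_gt0; rewrite -Nc; case: N {Nc}.
have c_gt0 : (0 < c)%N by move: d_gt0; rewrite -Nc muln_gt0 => /andP[].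
rewrite -{2}(natr_Zmod d_gt0 x) -{2}(natr_Zmod d_gt0 y) -!mulrnA -!val_eqE /=.
rewrite !(Zmod_nat N_gt0) !(Zmod_nat d_gt0).
have modE (z : Zmod d) : (z * c %% d = z %% N * c)%N by rewrite muln_modl Nc.
by rewrite !modE eqn_pmul2r.
Qed.

(** By Bezout. It lets an annihilator be replaced by its gcd with [d]. *)
Lemma mulrn_gcdn (V : zmodType) (x : V) (b c : nat) :
  (0 < b)%N -> x *+ b = 0 -> x *+ c = 0 -> x *+ gcdn b c = 0.
Proof.
move=> b_gt0 xb xc; have [q _ /dvdnP[p pE]] := Bezoutl c b_gt0.
have : x *+ (gcdn b c + q * c)%N = 0 by rewrite pE mulnC mulrnA xb mul0rn.
by rewrite mulrnDr [(q * c)%N]mulnC mulrnA xc mul0rn addr0.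
Qed.

(** * Splitting hyperbolic pairs off an isotropic subgroup *)

Section SymplecticFamilies.
Variables (d n : nat) (d_gt0 : (0 < d)%N).
Local Notation F := 'rV[Zmod d]_(n + n).
Implicit Types (x y z : F) (m : nat) (e f : 'I_n -> F).

(* Only the pairs of index at least [m] matter: partial families are extended
   downwards, towards [m = 0]. *)
Definition symplectic_from m e f := forall i j : 'I_n, (m <= i)%N -> (m <= j)%N ->
  [/\ phi (e i) (e j) = 0, phi (f i) (f j) = 0 & phi (e i) (f j) = (i == j)%:R].

Definition perp m e f : {set F} :=
  [set x | [forall i : 'I_n, (m <= i)%N ==> (phi x (e i) == 0) && (phi x (f i) == 0)]].

(** For a symplectic family, the projection onto [perp m e f] along the span of the pairs of index
    at least [m]. *)
Definition perp_proj m e f x :=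
  x - \sum_(i < n | (m <= i)%N) (phi x (f i) *: e i - phi x (e i) *: f i).

Lemma perpP m e f x :
  reflect (forall i : 'I_n, (m <= i)%N -> phi x (e i) = 0 /\ phi x (f i) = 0)
          (x \in perp m e f).
Proof.
rewrite inE; apply: (iffP forallP) => xP i; have := xP i.
  by move=> /implyP im /im/andP[/eqP-> /eqP->].
by move=> im; apply/implyP => /im[-> ->]; rewrite eqxx.
Qed.

Fact perp_group_set m e f : group_set (perp m e f).
Proof.
apply/group_setP; split=> [|x y /perpP xP /perpP yP]; apply/perpP => i im.
  by rewrite !phi0l.
have [x1 x2] := xP i im; have [y1 y2] := yP i im.
by rewrite !phiDl x1 x2 y1 y2 addr0.
Qed.

Canonical perp_group m e f := Group (perp_group_set m e f).

Lemma perp_projMn m e f x c : perp_proj m e f (x *+ c) = perp_proj m e f x *+ c.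
Proof.
rewrite /perp_proj mulrnBl -sumrMnl; congr (_ - _); apply: eq_bigr => i _.
by rewrite !phiMnl mulrnBl -!scalerMnl.
Qed.

Lemma perp_proj_id m e f x : x \in perp m e f -> perp_proj m e f x = x.
Proof.
move=> /perpP xP; rewrite /perp_proj big1 ?subr0 // => i im.
by have [-> ->] := xP i im; rewrite !scale0r subr0.
Qed.

Lemma phi_perp_proj m e f x y : y \in perp m e f -> phi (perp_proj m e f x) y = phi x y.
Proof.
move=> /perpP yP; rewrite /perp_proj phiDl phiNl phi_suml big1 ?subr0 // => i im.
have [y1 y2] := yP i im.
by rewrite phiDl phiNl !phiZl ![phi _ y]phi_skew y1 y2 !oppr0 !mulr0 subr0.
Qed.

Lemma perp_projP m e f x : symplectic_from m e f -> perp_proj m e f x \in perp m e f.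
Proof.
move=> ef; apply/perpP => j jm; rewrite /perp_proj !phiDl !phiNl !phi_suml.
have term (i : 'I_n) : (m <= i)%N ->
    phi (phi x (f i) *: e i - phi x (e i) *: f i) (e j) = phi x (e i) * (i == j)%:R /\
    phi (phi x (f i) *: e i - phi x (e i) *: f i) (f j) = phi x (f i) * (i == j)%:R.
  move=> im; have [e1 f1 ef1] := ef i j im jm; have [_ _ ef2] := ef j i jm im.
  rewrite !phiDl !phiNl !phiZl e1 f1 ef1 [phi (f i) _]phi_skew ef2 (eq_sym j).
  by rewrite !mulr0 subr0 sub0r mulrN opprK.
split; rewrite (bigD1 j) //=; [rewrite (term j jm).1|rewrite (term j jm).2];
  rewrite eqxx mulr1 big1 ?addr0 ?subrr // => i /andP[im /negPf ij].
  by rewrite (term i im).1 ij mulr0.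
by rewrite (term i im).2 ij mulr0.
Qed.

(* Otherwise, for [c] dividing [d] and [N = d / c > 1], a vector would be
   determined modulo [N] by its [n - 1] pairs of products with the family. *)
Lemma perp_torsion (i0 : 'I_n) e f c : symplectic_from i0.+1 e f ->
  (forall x, x \in perp i0.+1 e f -> x *+ c = 0) -> (d %| c)%N.
Proof.
move=> ef W0; pose b := gcdn d c; have bd : (b %| d)%N := dvdn_gcdl d c.
have {}W0 x : x \in perp i0.+1 e f -> x *+ b = 0.
  by move=> xW; apply: mulrn_gcdn (W0 _ xW); rewrite ?mulrn_row.
suff /eqP db : d == b by rewrite db dvdn_gcdr.
pose N := (d %/ b)%N; have Nb : (N * b = d)%N by rewrite divnK.
have N_gt0 : (0 < N)%N by move: d_gt0; rewrite -Nb; case: (N).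
pose lft (u : 'rV[Zmod N]_(n + n)) : F := \row_j (u 0 j : nat)%:R.
(* Injectivity of [psi] comes from the pairs above [i0]; indexing by all [i != i0] gives a target
   with [N ^ (2 (n - 1))] elements whatever [i0] is. *)
pose I := {i : 'I_n | i != i0}.
pose psi u : {ffun I -> Zmod N * Zmod N} :=
  [ffun i => ((phi (lft u) (e (val i)) : nat)%:R, (phi (lft u) (f (val i)) : nat)%:R)].
have psi_inj : injective psi.
  move=> u v /ffunP uv; have eq0 (i : 'I_n) : (i0.+1 <= i)%N ->
      phi (lft u) (e i) *+ b = phi (lft v) (e i) *+ b /\
      phi (lft u) (f i) *+ b = phi (lft v) (f i) *+ b.
    move=> im; have ni : i != i0 by apply: contraTneq im => ->; rewrite ltnn.
    have := uv (Sub i ni); rewrite !ffunE /= => -[] /eqP + /eqP.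
    by rewrite !(Zmod_reduction _ _ d_gt0 Nb) => /eqP-> /eqP->.
  (* After multiplication by [b], the difference is orthogonal to the family, hence equal to its
     projection, which [b] kills. *)
  have : (lft u - lft v) *+ b = 0.
    have := W0 _ (perp_projP (lft u - lft v) ef); rewrite -perp_projMn.
    rewrite /perp_proj big1 ?subr0 // => i im; have [E1 E2] := eq0 i im.
    by rewrite !phiMnl !phiDl !phiNl !mulrnBl E1 E2 !subrr !scale0r subr0.
  rewrite mulrnBl => /subr0_eq/rowP uvb; apply/rowP => j.
  have lt_d (w : Zmod N) : (w < d)%N.
    by apply: leq_trans (ltn_Zmod N_gt0 w) _; rewrite -Nb leq_pmulr // gcdn_gt0 d_gt0.
  have := uvb j; rewrite !mulmxnE !mxE => /eqP; rewrite -(Zmod_reduction _ _ d_gt0 Nb).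
  by rewrite !(Zmod_nat d_gt0) !modn_small ?lt_d // !(natr_Zmod N_gt0) => /eqP.
(* Counting gives [N ^ (2 n) <= N ^ (2 (n - 1))], which forces [N = 1]. *)
have := leq_card psi psi_inj.
rewrite card_mx card_ffun card_prod card_sig !card_ord prednK // mul1n.
have -> : #|[pred x | x != i0]| = n.-1 by rewrite cardC1 card_ord.
rewrite addnn -muln2 mulnC expnM -[(N * N)%N]/(N ^ 2)%N => le_exp.
have N_le1 : (N <= 1)%N.
  rewrite leqNgt; apply/negP => N_gt1; move: le_exp; rewrite leqNgt => /negP; apply.
  rewrite ltn_exp2l ?prednK ?(leq_ltn_trans _ (ltn_ord i0)) //.
  by rewrite -[X in (X < _)%N](exp1n 2) ltn_exp2r.
have N1 : N = 1%N by apply/eqP; rewrite eqn_leq N_le1 N_gt0.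
by rewrite -Nb N1 mul1n.
Qed.

(** Choose [y] in the orthogonal with [phi x y] of largest order. By projection and nondegeneracy,
    an integer killing [phi x y] kills [x]; so [phi x y] has order [d], is a unit, and [y] can be
    rescaled. *)
Lemma hyperbolic_partner m e f x : symplectic_from m e f -> x \in perp m e f ->
    (forall c, x *+ c = 0 -> (d %| c)%N) ->
  exists2 y, y \in perp m e f & phi x y = 1.
Proof.
move=> ef xW ox.
have kerG : group_set [set y : F | phi x y == 0].
  apply/group_setP; split=> [|y z]; rewrite !inE ?phi0r // => /eqP y0 /eqP z0.
  by rewrite phiDr y0 z0 addr0.
have abF : abelian [set: F] by exact: FinRing.zmod_abelian.
have [y yW ymax] := exponent_witness_mod (perp_group m e f) (Group kerG) abF.
have full c : phi x y *+ c = 0 -> (d %| c)%N.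
  move=> yc; apply: ox; apply: phi_nondeg => z.
  have zW := perp_projP z ef; have := ymax c.
  rewrite inE phiMnr yc eqxx => /(_ isT _ zW); rewrite inE phiMnr => /eqP.
  by rewrite phi_skew phi_perp_proj // phi_skew opprK phiMnl.
set u := phi x y in full.
have cop : coprime u d.
  have g_gt0 : (0 < gcdn u d)%N by rewrite gcdn_gt0 d_gt0 orbT.
  have /dvdn_leq : (d %| d %/ gcdn u d)%N.
    apply: full; apply/eqP; rewrite -(natr_Zmod d_gt0 u) -mulrnA (Zmod_nat_eq0 d_gt0).
    by rewrite (natr_Zmod d_gt0) muln_divCA ?dvdn_gcdl ?dvdn_gcdr // dvdn_mulr.
  rewrite divn_gt0 // dvdn_leq ?dvdn_gcdr // leq_divRL // => /(_ isT) le.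
  by rewrite /coprime eqn_leq g_gt0 andbT -(leq_pmul2l d_gt0) muln1.
(* Bezout over the naturals gives [d] dividing [1 + c u], hence the sign of the witness. *)
have [c _] := Bezoutr u d_gt0; rewrite (eqP cop) => dc.
exists (- (y *+ c)).
  exact: (groupVr (G := perp_group m e f) (groupX (G := perp_group m e f) c yW)).
rewrite phiNr phiMnr -/u; apply/eqP; rewrite eq_sym -subr_eq0 opprK.
by rewrite -(natr_Zmod d_gt0 u) -mulrnA -(natrD _ 1) (Zmod_nat_eq0 d_gt0) mulnC.
Qed.

Section Lagrangian.
Variables (L : {group F}) (k : nat).
Hypothesis isoL : forall x y, x \in L -> y \in L -> phi x y = 0.
Implicit Types (a : 'I_n -> nat).

(** [L] stands for [tau(H)]. The pairs below [k] will carry the generators of the shift, those from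
    [k] on the Pauli group of the quotient. *)
Definition adapted m e f a := forall i : 'I_n, (m <= i)%N ->
  if (i < k)%N then [/\ (a i %| d)%N, e i *+ a i \in L & f i *+ (d %/ a i)%N \in L]
  else forall x, x \in L -> phi x (e i) = 0 /\ phi x (f i) = 0.

(** Together with [isoL], this makes the part of [L] inside [perp m e f] the full orthogonal of [L]
    there. *)
Definition lagrangian m e f := forall x,
  (forall y, y \in L -> phi x y = 0) -> x \in perp m e f -> x \in L.

Lemma mulrn_mem x c b : x *+ b \in L -> (b %| c)%N -> x *+ c \in L.
Proof. by move=> xL /dvdnP[q ->]; rewrite mulnC mulrnA -zmodXgE groupX. Qed.

Lemma subr_mem x y : x \in L -> y \in L -> x - y \in L.
Proof. by move=> xL yL; rewrite -zmodMgE -zmodVgE groupM ?groupV. Qed.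

(** Orthogonality to [a_i e_i] makes [phi x (e i)] a multiple of [d / a_i], and orthogonality to
    [(d / a_i) f_i] makes [phi x (f i)] a multiple of [a_i]. *)
Lemma adapted_term m e f a x (i : 'I_n) : adapted m e f a -> (m <= i)%N -> (i < k)%N ->
    (forall y, y \in L -> phi x y = 0) ->
  phi x (f i) *: e i - phi x (e i) *: f i \in L.
Proof.
move=> efa im ik xL; have := efa i im; rewrite ik => -[ad eL fL].
have da : (d %/ (d %/ a i) = a i)%N by rewrite divnA // mulKn.
rewrite !scale_Zmod //; apply: subr_mem; [apply: mulrn_mem eL _|apply: mulrn_mem fL _].
  by rewrite -{1}da; apply: Zmod_torsion; rewrite ?dvdn_div // -phiMnr xL.
by apply: Zmod_torsion; rewrite // -phiMnr xL.
Qed.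

Lemma perp_proj_mem m e f a x : adapted m e f a -> x \in L -> perp_proj m e f x \in L.
Proof.
move=> efa xL; apply: subr_mem => //.
apply: (big_ind (fun u => u \in L)) => [|u v uL vL|i im]; first exact: (group1 L).
  by rewrite -zmodMgE groupM.
have [ki|ik] := leqP k i; last by apply: adapted_term efa im ik _ => y; exact: isoL.
have := efa i im; rewrite ltnNge ki => /(_ x xL)[-> ->].
by rewrite !scale0r subrr (group1 L).
Qed.

(** The descent step. The vector [e0] has largest order in the group [A] of those [x] in [W] with
    [a0 x] in [L]; the main point is that this order is [d]. *)
Lemma adapted_extend (i0 : 'I_n) e f a : (i0 < k)%N ->
    symplectic_from i0.+1 e f -> adapted i0.+1 e f a -> lagrangian i0.+1 e f ->
  exists e' f' a', [/\ symplectic_from i0 e' f', adapted i0 e' f' a' & lagrangian i0 e' f'].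
Proof.
move=> i0k ef efa lag; set W := perp_group i0.+1 e f.
pose E := exponent (L :&: W)%g; pose a0 := (d %/ E)%N.
have abF : abelian [set: F] by exact: FinRing.zmod_abelian.
have Ed : (E %| d)%N by apply/exponentP => x _; rewrite zmodXgE mulrn_row.
have Ea0 : (a0 * E = d)%N by rewrite divnK.
have E_gt0 : (0 < E)%N by exact: dvdn_gt0 Ed.
have a0d : (a0 %| d)%N by exact: dvdn_div.
have a0_gt0 : (0 < a0)%N by exact: dvdn_gt0 a0d.
have LWE x : x \in L -> x \in W -> x *+ E = 0.
  by move=> xL xW; rewrite -zmodXgE expg_exponent // inE xL.
have AG : group_set [set x in W | x *+ a0 \in L].
  apply/group_setP; split=> [|x y /setIdP[xW xL] /setIdP[yW yL]]; apply/setIdP.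
    by split; rewrite ?[_ *+ _]mul0rn; exact: group1.
  split; first exact: (groupM (G := W)).
  by rewrite mulrnDl -zmodMgE groupM.
have [e0 e0A e0max] := exponent_witness_mod (Group AG) 1%G abF.
have [e0W e0L] : e0 \in W /\ e0 *+ a0 \in L.
  by case/setIdP: e0A.
have {}e0max c : e0 *+ c = 0 -> (d %| c)%N.
  (* An integer killing [e0] kills all of [A], by maximality of the order. *)
  move=> e0c; have {e0max}Ac x : x \in W -> x *+ a0 \in L -> x *+ c = 0.
    move=> xW xL; have := e0max c; rewrite zmodXgE e0c group1 => /(_ isT x).
    by rewrite (introT setIdP (conj xW xL)) => /(_ isT) /set1P.
  (* [A] contains [E W], so [c E] kills [W] and [d] divides [c E]. *)
  have /dvdnP[q cE] : (a0 %| c)%N.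
    rewrite /a0 dvdn_divLR //; apply: (perp_torsion ef) => x xW.
    rewrite mulnC mulrnA Ac -?mulrnA //; first exact: (groupX (G := W)).
    by rewrite mulnC Ea0 mulrn_row // (group1 L).
  (* It remains that [E] divides [q]: each [x] in [L] and [W] is [a0 y] with [y] in [A], so
     [q x = c y = 0]. *)
  rewrite cE -Ea0 mulnC dvdn_pmul2r //; apply/exponentP => x /setIP[xL xW].
  have [y xE] := row_torsion d_gt0 Ed (LWE x xL xW).
  have {}xE : x = perp_proj i0.+1 e f y *+ a0 by rewrite -perp_projMn -xE perp_proj_id.
  by rewrite zmodXgE xE -mulrnA mulnC -cE Ac ?perp_projP // -xE.
have [f0 f0W ef0] := hyperbolic_partner ef e0W e0max.
(* An element of [L] has the same product with [f0] as its projection to [W], which lies in [L] and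
   is killed by [E]; so [E f0] is orthogonal to [L]. *)
have f0L : f0 *+ (d %/ a0)%N \in L.
  have -> : (d %/ a0 = E)%N by rewrite -[X in (X %/ _)%N]Ea0 mulKn.
  apply: lag; last exact: (groupX (G := W)).
  move=> y yL; rewrite phiMnl phi_skew -(phi_perp_proj y f0W) mulNrn -phiMnl.
  by rewrite LWE ?perp_projP ?phi0l ?oppr0 // (perp_proj_mem efa).
move/perpP: e0W => e0W; move/perpP: f0W => f0W.
pose upd T (g : 'I_n -> T) g0 i := if i == i0 then g0 else g i.
have far (i : 'I_n) : (i0 <= i)%N -> i != i0 -> (i0 < i)%N.
  by move=> im ni; rewrite ltn_neqAle im andbT eq_sym.
exists (upd F e e0), (upd F f f0), (upd nat a a0); rewrite /upd; split.
- move=> i j im jm; case: (eqVneq i i0) => [->|ni]; case: (eqVneq j i0) => [jE|nj].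
  + by rewrite !phi_alt ef0.
  + have [e1 e2] := e0W j (far j jm nj); have [f1 f2] := f0W j (far j jm nj).
    by rewrite e1 e2 f2.
  + have [e1 e2] := e0W i (far i im ni); have [f1 f2] := f0W i (far i im ni).
    by rewrite jE (phi_skew (e i)) (phi_skew (f i)) (phi_skew (e i) f0) e1 f1 f2 oppr0 (negPf ni).
  + exact: ef (far i im ni) (far j jm nj).
- move=> i im; case: (eqVneq i i0) => [->|ni]; first by rewrite i0k.
  exact: efa (far i im ni).
(* A further pair shrinks the orthogonal, so the condition is inherited. *)
- move=> x xL /perpP xP; apply: lag => //; apply/perpP => i im.
  have := xP i (ltnW im); case: (eqVneq i i0) im => [->|//]; by rewrite ltnn.
Qed.

Lemma adapted_basis e f : (k <= n)%N ->
    symplectic_from k e f ->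
    (forall i : 'I_n, (k <= i)%N ->
       forall x, x \in L -> phi x (e i) = 0 /\ phi x (f i) = 0) ->
    lagrangian k e f ->
  exists e' f' a, symplectic_from 0 e' f' /\ adapted 0 e' f' a.
Proof.
move=> kn ef efL lag.
suff : forall j, (j <= k)%N -> exists e' f' a,
    [/\ symplectic_from (k - j) e' f', adapted (k - j) e' f' a & lagrangian (k - j) e' f'].
  by move=> /(_ k (leqnn k)); rewrite subnn => -[e' [f' [a [? ? _]]]]; exists e', f', a.
elim=> [_|j IHj jk].
  (* At the start no index lies both from [k] on and below [k]: the value [1] is a placeholder. *)
  exists e, f, (fun=> 1%N); rewrite subn0; split=> // i im.
  by rewrite ltnNge im; exact: efL.
have [e' [f' [a [ef' efa' lag']]]] := IHj (ltnW jk).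
have lt_kj : (k - j.+1 < k)%N by rewrite ltn_subrL (leq_ltn_trans _ jk).
have lt_n := leq_trans lt_kj kn.
have kjE : (k - j = (Ordinal lt_n).+1)%N by rewrite /= subnSK.
rewrite kjE in ef' efa' lag'; exact: adapted_extend ef' efa' lag'.
Qed.

End Lagrangian.

Section Basis.
Variables (e f : 'I_n -> F).
Hypothesis ef : symplectic_from 0 e f.

Let b (s : 'I_n + 'I_n) := match s with inl i => e i | inr i => f i end.
Let comb (c : {ffun 'I_n + 'I_n -> Zmod d}) := \sum_s c s *: b s.

Lemma phi_combf c j : phi (comb c) (f j) = c (inl j).
Proof.
rewrite phi_suml big_sumType /= addrC big1 ?add0r; last first.
  by move=> i _; rewrite phiZl; have [_ -> _] := ef (leq0n i) (leq0n j); rewrite mulr0.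
rewrite (bigD1 j) //= big1 ?addr0 => [|i /negPf ij]; rewrite phiZl.
  by have [_ _ ->] := ef (leq0n j) (leq0n j); rewrite eqxx mulr1.
by have [_ _ ->] := ef (leq0n i) (leq0n j); rewrite ij mulr0.
Qed.

Lemma phi_combe c j : phi (comb c) (e j) = - c (inr j).
Proof.
rewrite phi_suml big_sumType /= big1 ?add0r; last first.
  by move=> i _; rewrite phiZl; have [-> _ _] := ef (leq0n i) (leq0n j); rewrite mulr0.
rewrite (bigD1 j) //= big1 ?addr0 => [|i /negPf ij]; rewrite phiZl phi_skew.
  by have [_ _ ->] := ef (leq0n j) (leq0n j); rewrite eqxx mulrN1.
by have [_ _ ->] := ef (leq0n j) (leq0n i); rewrite eq_sym ij oppr0 mulr0.
Qed.

Lemma comb_inj : injective comb.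
Proof.
move=> c c' cc; apply/ffunP => -[] j; first by rewrite -!phi_combf cc.
by apply: oppr_inj; rewrite -!phi_combe cc.
Qed.

(** Injectivity suffices, as both sides have [d ^ (2 n)] elements. *)
Lemma comb_surj x : exists c, x = comb c.
Proof.
apply/codomP/(inj_card_onto comb_inj).
by rewrite card_ffun card_mx !card_ord card_sum !card_ord mul1n.
Qed.

Lemma symplectic_expansion x :
  x = \sum_i (phi x (f i) *: e i - phi x (e i) *: f i).
Proof.
have [c ->] := comb_surj x; rewrite {1}/comb big_sumType /= -big_split /=.
by apply: eq_bigr => i _; rewrite phi_combf phi_combe scaleNr opprK.
Qed.

Lemma symplectic_from0_basis : symplectic_basis e f.
Proof.
split=> [|i j]; last exact: ef.
split; last exact: comb_inj.
apply/setP => x; rewrite inE; apply/esym/imsetP.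
by have [c ->] := comb_surj x; exists c.
Qed.

Lemma is_basis_sub m (w : 'I_m -> 'I_n) (S : {set F}) : injective w ->
    S = [set \sum_i c i *: e (w i) | c : {ffun 'I_m -> Zmod d}] ->
  is_basis (e \o w) S.
Proof.
move=> w_inj SE; split=> // c c' /= cc; apply/ffunP => j.
have coef (a : {ffun 'I_m -> Zmod d}) : phi (\sum_i a i *: e (w i)) (f (w j)) = a j.
  rewrite phi_suml (bigD1 j) //= big1 ?addr0 => [|i /negPf ij]; rewrite phiZl.
    by have [_ _ ->] := ef (leq0n (w j)) (leq0n (w j)); rewrite eqxx mulr1.
  have [_ _ ->] := ef (leq0n (w i)) (leq0n (w j)).
  by rewrite (inj_eq w_inj) ij mulr0.
by rewrite -coef cc coef.
Qed.

End Basis.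

(* Expanding [x] in the family, the coordinates from [k] on vanish and the
   others are multiples of [a i] and [d / a i]. *)
Lemma adapted_lagrangian (L : {group F}) k e f a x :
    symplectic_from 0 e f -> adapted L k 0 e f a ->
    (forall y, y \in L -> phi x y = 0) -> x \in perp k e f -> x \in L.
Proof.
move=> ef efa xL /perpP xP; rewrite (symplectic_expansion ef x).
apply: (big_ind (fun u => u \in L)) => [|u v uL vL|i _]; first exact: (group1 L).
  by rewrite -zmodMgE groupM.
have [ki|ik] := leqP k i.
  by have [-> ->] := xP i ki; rewrite !scale0r subrr (group1 L).
exact: adapted_term efa _ ik xL.
Qed.

End SymplecticFamilies.

(** * Commutation and lifting in the Pauli group *)

Section PauliGroup.
Variables (C : numClosedFieldType) (d : nat) (zeta : C).
Hypothesis zetaP : (dbar d).-primitive_root zeta.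
Variable n : nat.
Local Notation V := (qudits C d n).
Local Notation T := 'rV[Zmod d]_n.
Local Notation P := (pauli zetaP n).
Local Notation tau := (@tau C d zeta zetaP n).
Local Notation Z := (pauli_zeta zetaP n).
Implicit Types (g h : P) (u v : V) (s t : T) (x y : Zmod d).

Let d_gt0 : (0 < d)%N := d_gt0 zetaP.

(** The faithful character of the additive group [Z/d] through which [phi] enters identities between
    operators. *)
Definition xi_pow x : C := (zeta ^+ 2) ^+ (x : nat).

Lemma xi_pow0 : xi_pow 0 = 1. Proof. by rewrite /xi_pow expr0. Qed.

Lemma xi_powD x y : xi_pow (x + y) = xi_pow x * xi_pow y.
Proof. by rewrite /xi_pow -exprD -(xi_mod zetaP (x + y)%N). Qed.

Lemma xi_powM x y : xi_pow (x * y) = (zeta ^+ 2) ^+ (x * y)%N.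
Proof. by rewrite -(xi_mod zetaP (x * y)%N). Qed.

Lemma xi_pow_neq0 x : xi_pow x != 0.
Proof. by rewrite !expf_neq0 // (zeta_neq0 zetaP). Qed.

Lemma xi_powN x : xi_pow (- x) = (xi_pow x)^-1.
Proof.
by apply: (mulfI (xi_pow_neq0 x)); rewrite -xi_powD subrr xi_pow0 divff ?xi_pow_neq0.
Qed.

Lemma xi_pow_eq1 x : (xi_pow x == 1) = (x == 0).
Proof.
rewrite -(prim_order_dvd (xi_prim zetaP)) -[in RHS](natr_Zmod d_gt0 x).
by rewrite (Zmod_nat_eq0 d_gt0).
Qed.

Lemma chi_dot s t : chi zeta s t = xi_pow (\sum_r s 0 r * t 0 r).
Proof.
rewrite (big_morph xi_pow xi_powD xi_pow0); apply: eq_bigr => r _.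
by rewrite xi_powM.
Qed.

Lemma qudits_sum v : v = \sum_t (v t : C) *: tensor_basis C t.
Proof.
apply/ffunP => s; rewrite sum_ffunE (bigD1 s) //= !ffunE eqxx big1 ?addr0.
  by rewrite [RHS]mulr1.
by move=> t nt; rewrite !ffunE eq_sym (negPf nt) [LHS]mulr0.
Qed.

Definition phase g : C := zeta ^+ (normal_form g).1.1.
Definition zpart g : T := (normal_form g).1.2.
Definition xpart g : T := (normal_form g).2.

Lemma tauE g : tau g = row_mx (zpart g) (xpart g). Proof. by []. Qed.

Lemma pauli_opE g t : pauli_op g (tensor_basis C t) =
  (phase g * chi zeta (zpart g) t) *: tensor_basis C (t + xpart g).
Proof. exact: normal_formP. Qed.

Lemma pauli_coord g v s :
  pauli_op g v s = phase g * chi zeta (zpart g) (s - xpart g) * v (s - xpart g).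
Proof.
rewrite [in LHS](qudits_sum v) linear_sum sum_ffunE (bigD1 (s - xpart g)) //= big1 ?addr0.
  by rewrite linearZ /= pauli_opE !ffunE subrK eqxx [_ *: 1]mulr1 [LHS]mulrC.
move=> t nt; rewrite linearZ /= pauli_opE !ffunE.
by rewrite -subr_eq (eq_sym _ t) (negPf nt) [X in _ *: X]mulr0 [LHS]mulr0.
Qed.

Lemma norm_chi s t : `|chi zeta s t| = 1.
Proof.
apply/eqP; rewrite -(@pexpr_eq1 _ _ (dbar d)) ?normr_ge0 ?(prim_order_gt0 zetaP) //.
by rewrite -normrX (chi_dbar zetaP) normr1.
Qed.

Lemma norm_zeta : `|zeta| = 1.
Proof.
apply/eqP; rewrite -(@pexpr_eq1 _ _ (dbar d)) ?normr_ge0 ?(prim_order_gt0 zetaP) //.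
by rewrite -normrX (prim_expr_order zetaP) normr1.
Qed.

Lemma norm_phase g : `|phase g| = 1.
Proof. by rewrite normrX norm_zeta expr1n. Qed.

Lemma hdot_pauli g u v : hdot (pauli_op g u) (pauli_op g v) = hdot u v.
Proof.
rewrite /hdot (reindex_inj (addIr (xpart g))) /=; apply: eq_bigr => t _.
rewrite !pauli_coord addrK !rmorphM /= mulrACA -[RHS]mul1r; congr (_ * _).
by rewrite mulrACA -!normCK norm_phase norm_chi !expr1n mulr1.
Qed.

Lemma pauli_opZ k v : pauli_op (Z ^+ k)%g v = (zeta ^+ k : C) *: v.
Proof. by rewrite pauli_zetaX scale_lfunE id_lfunE. Qed.

(** On a basis vector the two orders differ by the ratio of [chi (zpart g) (xpart h)] and
    [chi (zpart h) (xpart g)], whose exponent is [phi]. *)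
Lemma pauli_op_swap g h v :
  pauli_op (g * h)%g v = xi_pow (phi (tau g) (tau h)) *: pauli_op (h * g)%g v.
Proof.
rewrite -scale_lfunE; congr (fun_of_lfun _ v); apply: qudits_ext => t.
rewrite scale_lfunE !pauli_opM !comp_lfunE !pauli_opE !linearZ /= !pauli_opE !scalerA.
rewrite addrAC; congr (_ *: _); rewrite !(chiDr zetaP).
have -> : chi zeta (zpart g) (xpart h) =
    xi_pow (phi (tau g) (tau h)) * chi zeta (zpart h) (xpart g).
  rewrite !chi_dot -xi_powD; congr xi_pow; rewrite /phi -big_split /=.
  by apply: eq_bigr => r _; rewrite !tauE !row_mxEl !row_mxEr; ring.
ring.
Qed.

Lemma pauli_swap g h : (g * h = Z ^+ (2 * phi (tau g) (tau h)) * (h * g))%g.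
Proof.
apply/pauli_op_inj/lfunP => v; rewrite pauli_op_swap [in RHS]pauli_opM comp_lfunE.
by rewrite pauli_opZ exprM.
Qed.

Lemma order_zeta : #[Z]%g = dbar d.
Proof.
apply/eqP; rewrite eqn_dvd; apply/andP; split.
  rewrite order_dvdn; apply/eqP/pauli_op_inj/lfunP => v.
  by rewrite pauli_opZ (prim_expr_order zetaP) scale1r pauli_op1 id_lfunE.
rewrite (prim_order_dvd zetaP); have := pauli_opZ #[Z]%g (tensor_basis C 0).
rewrite expg_order pauli_op1 id_lfunE => /ffunP/(_ 0); rewrite !ffunE eqxx.
by rewrite [_ *: _]mulr1 => <-.
Qed.

Lemma pauli_commuteP g h : reflect (commute g h) (phi (tau g) (tau h) == 0).
Proof.
rewrite -xi_pow_eq1 /xi_pow -exprM -(prim_order_dvd zetaP) -order_zeta order_dvdn.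
apply: (iffP eqP) => [gh|]; rewrite /commute pauli_swap.
  by rewrite gh mul1g.
by rewrite -{2}[(h * g)%g]mul1g => /mulIg.
Qed.

Lemma tauX_nat g k : tau (g ^+ k)%g = tau g *+ k.
Proof. by elim: k => [|k IHk]; rewrite ?tau1 // expgS tauM IHk mulrS. Qed.

Lemma tauV g : tau (g^-1)%g = - tau g.
Proof. by apply: (addrI (tau g)); rewrite -tauM mulgV tau1 subrr. Qed.

Lemma tau_eqP g h : reflect (exists c, g = h * Z ^+ c)%g (tau g == tau h).
Proof.
rewrite -subr_eq0 addrC -tauV -tauM tau_ker.
apply: (iffP (cycleP _ _)) => -[c gE]; exists c; first by rewrite -gE mulKVg.
by rewrite gE mulKg.
Qed.

Lemma tau_zetaX c : tau (Z ^+ c)%g = 0.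
Proof. by apply/eqP; rewrite tau_ker mem_cycle. Qed.

Lemma zeta_central g : commute g Z.
Proof.
by apply/pauli_commuteP; rewrite (tau_zetaX 1) phi0r.
Qed.

Lemma scalar_free1 (H : {group P}) h : scalar_free H -> h \in H -> tau h = 0 -> h = 1%g.
Proof.
move=> sfH hH /eqP; rewrite tau_ker => hZ.
by have /setP/(_ h) := sfH; rewrite inE hH hZ => /esym/set1gP.
Qed.

Lemma commuteZ g c : commute g (Z ^+ c)%g. Proof. exact/commuteX/zeta_central. Qed.

(** The binomial coefficient counts how often a [Z] part passes an [X] part when the power is
    brought to normal form. *)
Lemma pauli_opX g k t : pauli_op (g ^+ k)%g (tensor_basis C t) =
  (phase g ^+ k * chi zeta (zpart g) t ^+ k * chi zeta (zpart g) (xpart g) ^+ 'C(k, 2))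
    *: tensor_basis C (t + xpart g *+ k).
Proof.
elim: k t => [|k IHk] t; first by rewrite pauli_op1 id_lfunE !expr0 !mulr1 scale1r addr0.
rewrite expgSr pauli_opM comp_lfunE pauli_opE linearZ /= IHk scalerA -addrA -mulrS.
congr (_ *: _); rewrite (chiDr zetaP) binS bin1 exprD exprMn !exprS; ring.
Qed.

(** As [xi] is a square, the binomial exponent gets doubled, and [2 C(dbar d, 2)] is a multiple of
    [dbar d]. *)
Lemma expg_dbar g : (g ^+ dbar d = 1)%g.
Proof.
apply/pauli_op_inj/qudits_ext => t; rewrite pauli_opX pauli_op1 id_lfunE.
have dd : (d %| dbar d)%N by rewrite /dbar; case: odd => //; rewrite -muln2 dvdn_mulr.
have -> : xpart g *+ dbar d = 0 by case/dvdnP: dd => q ->; rewrite mulnC mulrnA mulrn_row ?mul0rn.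
rewrite addr0 -exprM mulnC exprM (prim_expr_order zetaP) expr1n (chi_dbar zetaP) !mul1r.
rewrite chi_dot /xi_pow -!exprM (_ : zeta ^+ _ = 1) ?scale1r //.
set m := nat_of_ord _.
have bin : ('C(dbar d, 2) * 2 = dbar d * (dbar d).-1)%N.
  by have := bin_ffact (dbar d) 2; rewrite ffactnS ffactn1.
by rewrite mulnCA mulnC [(2 * _)%N]mulnC bin -mulnA exprM (prim_expr_order zetaP) expr1n.
Qed.

(** A lift is determined up to a power of [zeta], which is adjusted twice: first to make the [d]-th
    power trivial, then, keeping this, to bring the [b]-th power into [H]. With [b = d] only the
    first matters. *)
Lemma lift_of_order_d (H : {group P}) (u : 'rV[Zmod d]_(n + n)) b :
    scalar_free H -> (b %| d)%N -> u *+ b \in [set tau h | h in H] ->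
  exists g, [/\ tau g = u, (g ^+ d = 1)%g & (g ^+ b \in H)%g].
Proof.
move=> sfH bd /imsetP[h hH ubh].
have b_gt0 : (0 < b)%N := dvdn_gt0 d_gt0 bd.
have expgMZ g c k : ((g * Z ^+ c) ^+ k = g ^+ k * Z ^+ (c * k))%g.
  by rewrite expgMn ?expgM //; exact: commuteZ.
have [g0 g0u] := tau_surj zetaP u.
(* For odd [d] already [g0 ^ d = 1]; for even [d], [g0 ^ (2 d) = 1] makes the exponent of [zeta] in
   [g0 ^ d] a multiple of [d]. *)
have [r0 g0d] : exists r, (g0 ^+ d = Z ^+ (r * d))%g.
  have /cycleP[r rE] : (g0 ^+ d)%g \in <[Z]>%g.
    by rewrite -tau_ker tauX_nat mulrn_row.
  have := expg_dbar g0; rewrite /dbar; case: ifP => od.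
    by move=> ->; exists 0%N.
  rewrite -muln2 expgM rE -expgM => /eqP; rewrite -order_dvdn order_zeta /dbar od -muln2.
  by rewrite dvdn_pmul2r // => /dvdnP[q ->]; exists q.
have [g1 g1u g1d] : exists2 g, tau g = u & (g ^+ d = 1)%g.
  exists (g0 * Z^-1 ^+ r0)%g.
    by rewrite expgVn tauM tauV tau_zetaX oppr0 addr0.
  rewrite expgMn; last by apply/commuteX/commuteV; exact: zeta_central.
  by rewrite g0d -expgM expgVn mulgV.
have [c g1b] : exists c, (g1 ^+ b = h * Z ^+ c)%g.
  by apply/tau_eqP; rewrite tauX_nat g1u ubh.
(* [h ^ (d / b)] is a scalar of [H], hence trivial, which leaves a condition on [c] alone. *)
have : (Z ^+ (c * (d %/ b)) = 1)%g.
  have <- : (g1 ^+ b ^+ (d %/ b) = 1)%g by rewrite -expgM mulnC divnK.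
  rewrite g1b expgMZ (scalar_free1 (h := (h ^+ (d %/ b))%g) sfH) ?mul1g ?groupX //.
  by rewrite tauX_nat -ubh -mulrnA mulnC divnK // mulrn_row.
move/eqP; rewrite -order_dvdn order_zeta => dc.
(* Thus [zeta ^ c] is the [b]-th power of [zeta ^ q], and dividing by [zeta ^ q] preserves the
   [d]-th power. *)
have [q cE Zqd] : exists2 q, c = (q * b)%N & (Z ^+ (q * d) = 1)%g.
  have [e dE] : exists e, dbar d = (e * d)%N.
    by rewrite /dbar; case: odd; [exists 1%N; rewrite mul1n|exists 2%N; rewrite mul2n].
  move: dc; rewrite dE -{1}(divnK bd) mulnA mulnAC.
  have db_gt0 : (0 < d %/ b)%N by rewrite divn_gt0 // dvdn_leq.
  rewrite dvdn_pmul2r // => /dvdnP[q' ->].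
  exists (q' * e)%N; rewrite ?mulnA //.
  apply/eqP; rewrite -order_dvdn order_zeta dE -mulnA dvdn_mull //.
exists (g1 * (Z ^+ q)^-1)%g; split.
- by rewrite tauM tauV tau_zetaX oppr0 addr0.
- rewrite expgMn; last by apply/commuteV/commuteZ.
  by rewrite g1d mul1g expgVn -expgM Zqd invg1.
- rewrite expgMn; last by apply/commuteV/commuteZ.
  by rewrite g1b expgVn -expgM -cE mulgK.
Qed.

End PauliGroup.

Section CommutingPowers.
Variables (C : numClosedFieldType) (d : nat) (zeta : C).
Hypothesis zetaP : (dbar d).-primitive_root zeta.
Variables (n m : nat) (g : 'I_m -> pauli zetaP n).
Hypothesis g_comm : forall i j, commute (g i) (g j).
Hypothesis g_d : forall i, (g i ^+ d = 1)%g.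
Local Notation T := 'rV[Zmod d]_m.
Implicit Types s t : T.

Let d_gt0 : (0 < d)%N := d_gt0 zetaP.

(** The analogue of the monomials [X^t] and [Z^b]; [g_comm] and [g_d] make it a morphism from
    [(Z/d)^m]. *)
Definition pow_prod t : pauli zetaP n := (\prod_(i < m) g i ^+ (t 0%R i : Zmod d))%g.

Lemma pow_prodD s t : (pow_prod (s + t) = pow_prod s * pow_prod t)%g.
Proof.
have expD i : (g i ^+ ((s + t)%R 0%R i : Zmod d) =
               g i ^+ (s 0%R i : Zmod d) * g i ^+ (t 0%R i : Zmod d))%g.
  by rewrite mxE addn_Zmod // expg_mod // expgD.
rewrite /pow_prod; under eq_bigr => i _ do rewrite expD.
elim: (index_enum _) => [|i r IHr]; first by rewrite !big_nil mulg1.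
rewrite !big_cons IHr !mulgA; congr (_ * _)%g; rewrite -!mulgA; congr (_ * _)%g.
apply: (big_ind (commute (g i ^+ (t 0%R i : Zmod d))%g)) => [|x y|j _].
- exact: commute1.
- exact: commuteM.
- by apply/commuteX/commute_sym/commuteX.
Qed.

Lemma pow_prod_morphM : {in [set: T] &, {morph pow_prod : s t / (s * t)%g}}.
Proof. by move=> s t _ _; exact: pow_prodD. Qed.

Canonical pow_prod_morphism := Morphism pow_prod_morphM.

Lemma pow_prod0 : pow_prod 0 = 1%g.
Proof. exact: (morph1 pow_prod_morphism). Qed.

Lemma tau_pow_prod t : tau (pow_prod t) = \sum_i t 0 i *: tau (g i).
Proof.
rewrite /pow_prod (big_morph _ (@tauM _ _ _ zetaP n) (@tau1 _ _ _ zetaP n)).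
by apply: eq_bigr => i _; rewrite tauX_nat (scale_Zmod d_gt0).
Qed.

Lemma pow_prod_delta i : pow_prod (delta_mx 0 i) = g i.
Proof.
rewrite -[RHS](big_pred1_eq (mulg : Monoid.law _) i g) big_mkcond /=; apply: eq_bigr => j _.
rewrite mxE /= (Zmod_nat d_gt0) expg_mod //; by case: eqP => [->|_]; rewrite ?expg1 ?expg0.
Qed.

Lemma pow_prod_gen : (pow_prod @* [set: T] = <<[set g i | i : 'I_m]>>)%g.
Proof.
apply/eqP; rewrite eqEsubset; apply/andP; split; last first.
  rewrite gen_subG; apply/subsetP => _ /imsetP[i _ ->].
  by apply/morphimP; exists (delta_mx 0 i); rewrite ?inE //= pow_prod_delta.
apply/subsetP => _ /morphimP[t _ _ ->]; apply: group_prod => i _.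
by apply/groupX/mem_gen/imset_f.
Qed.

End CommutingPowers.

(** * Abelian subgroups without scalars and their normalisers *)

Section Isotropic.
Variables (C : numClosedFieldType) (d : nat) (zeta : C).
Hypothesis zetaP : (dbar d).-primitive_root zeta.
Variable n : nat.
Local Notation P := (pauli zetaP n).
Local Notation Z := (pauli_zeta zetaP n).
Local Notation F := 'rV[Zmod d]_(n + n).
Variable H : {group P}.
Hypotheses (abH : abelian H) (sfH : scalar_free H).
Implicit Types (g h : P).

Let d_gt0 : (0 < d)%N := d_gt0 zetaP.

Lemma tau_inj_in : {in H &, injective (@tau C d zeta zetaP n)}.
Proof.
move=> g h gH hH gh; apply/eqP; rewrite eq_mulgV1; apply/eqP.
by apply: (scalar_free1 sfH); rewrite ?groupM ?groupV // tauM tauV gh subrr.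
Qed.

Definition tau_set (K : {set P}) : {set F} := [set tau g | g in K].

Fact tau_group_set (K : {group P}) : group_set (tau_set K).
Proof.
apply/group_setP; split=> [|x y /imsetP[g gK ->] /imsetP[h hK ->]].
  by apply/imsetP; exists 1%g; rewrite ?tau1.
by apply/imsetP; exists (g * h)%g; rewrite ?groupM // tauM.
Qed.

Canonical tau_group (K : {group P}) := Group (tau_group_set K).

Lemma tau_set_isotropic x y : x \in tau_set H -> y \in tau_set H -> phi x y = 0.
Proof.
move=> /imsetP[g gH ->] /imsetP[h hH ->]; apply/eqP/pauli_commuteP.
exact: (centsP abH).
Qed.

(** A conjugate of [h] is [h] times a power of [zeta]; if it lies in [H], so does this scalar, which
    is then trivial. *)
Lemma normaliser_centraliser : 'N(H)%g = 'C(H)%g.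
Proof.
apply/eqP; rewrite eqEsubset cent_sub andbT; apply/subsetP => g gN.
apply/centP => h hH; apply: commute_sym.
have E : (conjg h g = Z ^+ (2 * phi (tau h) (tau g)) * h)%g.
  by rewrite conjgE (pauli_swap h) mulgA (commuteZ g^-1%g) -!mulgA mulKg.
have Z1 : (Z ^+ (2 * phi (tau h) (tau g)) = 1)%g.
  apply: (scalar_free1 sfH); last exact: tau_zetaX.
  by rewrite -(mulgK h (Z ^+ _)%g) -E groupM ?groupV // memJ_norm.
by rewrite /commute pauli_swap Z1 mul1g.
Qed.

Lemma normaliserP g :
  reflect (forall x, x \in tau_set H -> phi (tau g) x = 0) (g \in 'N(H)%g).
Proof.
rewrite normaliser_centraliser; apply: (iffP centP) => [gH x /imsetP[h hH ->]|gH h hH].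
  by apply/eqP/pauli_commuteP/gH.
by apply/pauli_commuteP/eqP/gH/imset_f.
Qed.

End Isotropic.

(** * From the quotient to a shift *)

Section QuotientIsPauli.
Variables (C : numClosedFieldType) (d : nat) (zeta : C).
Hypothesis zetaP : (dbar d).-primitive_root zeta.
Variables (n m : nat).
Local Notation P := (pauli zetaP n).
Local Notation Q := (pauli zetaP m).
Local Notation ZP := (pauli_zeta zetaP n).
Local Notation ZQ := (pauli_zeta zetaP m).
Variable H : {group P}.
Hypothesis sfH : scalar_free H.
Variable sigma : {morphism ('N(H) / H)%g >-> Q}.
Hypotheses (sigma_inj : ('injm sigma)%g) (sigma_im : (sigma @* ('N(H) / H) = [set: Q])%g).
Implicit Types g h : P.

Let d_gt0 : (0 < d)%N := d_gt0 zetaP.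
Let s g : Q := sigma (coset H g).

Let sM g h : g \in 'N(H)%g -> h \in 'N(H)%g -> s (g * h)%g = (s g * s h)%g.
Proof. by move=> gN hN; rewrite /s morphM ?morphM ?mem_quotient. Qed.

Let s_inj g h : g \in 'N(H)%g -> h \in 'N(H)%g -> s g = s h ->
  exists2 k, k \in H & g = (k * h)%g.
Proof.
move=> gN hN /(injmP sigma_inj) gh.
have /eqP : coset H g = coset H h by apply: gh; rewrite mem_quotient.
by rewrite -[_ == _]/(_ == _ :> coset_of H) => /eqP/rcoset_kercosetP/rcosetP[] // k; exists k.
Qed.

Lemma quotient_pauli_lift (q : Q) : exists2 g, g \in 'N(H)%g & s g = q.
Proof.
have : q \in (sigma @* ('N(H) / H))%g by rewrite sigma_im inE.
case/morphimP => x _ /morphimP[g _ gN ->] ->; by exists g.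
Qed.

Let sX g k : g \in 'N(H)%g -> s (g ^+ k)%g = (s g ^+ k)%g.
Proof. by move=> gN; rewrite /s !morphX ?mem_quotient. Qed.

Lemma zeta_norm : ZP \in 'N(H)%g.
Proof.
rewrite (normaliser_centraliser sfH); apply/centP => h _.
exact/commute_sym/zeta_central.
Qed.

(** Commutators are scalars and [H] has no others than [1], so commuting modulo [H] is commuting. *)
Lemma quotient_pauli_commute g h : g \in 'N(H)%g -> h \in 'N(H)%g ->
  (phi (tau g) (tau h) == 0) = (phi (tau (s g)) (tau (s h)) == 0).
Proof.
move=> gN hN; apply/pauli_commuteP/pauli_commuteP => [gh|].
  by rewrite /commute -!sM // gh.
rewrite /commute -!sM // => /s_inj [||k kH]; rewrite ?groupM // pauli_swap => /mulIg kE.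
suff k1 : k = 1%g by rewrite /commute pauli_swap kE k1 mul1g.
by apply: (scalar_free1 sfH) => //; rewrite -kE tau_zetaX.
Qed.

(** The image of [g] commutes with all standard generators, so it is a scalar by nondegeneracy; one
    preimage per generator is enough to test this. *)
Lemma tau_quotient_pauli_eq0 g : g \in 'N(H)%g ->
    (forall r, exists2 h, h \in 'N(H)%g & s h = pauliZ zetaP r /\ phi (tau g) (tau h) = 0) ->
    (forall r, exists2 h, h \in 'N(H)%g & s h = pauliX zetaP r /\ phi (tau g) (tau h) = 0) ->
  tau (s g) = 0.
Proof.
move=> gN gZ gX; apply: phi_nondeg_std => r.
  rewrite -(tauZ zetaP) phi_skew; have [h hN [<- /eqP]] := gZ r.
  by rewrite quotient_pauli_commute // => /eqP->; rewrite oppr0.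
rewrite -(tauX zetaP) phi_skew; have [h hN [<- /eqP]] := gX r.
by rewrite quotient_pauli_commute // => /eqP->; rewrite oppr0.
Qed.

(** As [zeta] is central, its image is a scalar. Its order does not drop, since [H] contains no
    nontrivial power of [zeta]. *)
Lemma quotient_pauli_zeta : (<[s ZP]> = <[ZQ]>)%g.
Proof.
have ZN := zeta_norm.
have comm g : phi (tau ZP) (tau g) = 0.
  by rewrite (tau_zetaX zetaP n 1) phi0l.
apply/eqP; rewrite eqEcard cycle_subG -tau_ker; apply/andP; split.
  apply/eqP/tau_quotient_pauli_eq0 => // r.
    by have [h hN hr] := quotient_pauli_lift (pauliZ zetaP r); exists h.
  by have [h hN hr] := quotient_pauli_lift (pauliX zetaP r); exists h.
rewrite -[#|_|]/(#[_]%g) -[X in (_ <= X)%N]/(#[_]%g) order_zeta dvdn_leq ?order_gt0 //.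
rewrite -(order_zeta zetaP n) order_dvdn.
have : s (ZP ^+ #[s ZP])%g = s 1%g by rewrite sX // expg_order /s !morph1.
case/s_inj; rewrite ?groupX // => k kH; rewrite mulg1 => E; rewrite E; apply/eqP.
by apply: (scalar_free1 sfH) => //; rewrite -E tau_zetaX.
Qed.

(** The image of [zeta] is [zeta ^ v]; compare the commutation relations before and after applying
    the isomorphism. *)
Lemma quotient_pauli_scale : exists v, forall g h, g \in 'N(H)%g -> h \in 'N(H)%g ->
  phi (tau g) (tau h) *+ v = phi (tau (s g)) (tau (s h)).
Proof.
have /cycleP[v vE] : s ZP \in <[ZQ]>%g by rewrite -quotient_pauli_zeta cycle_id.
exists v => g h gN hN; have ZN := zeta_norm.
have : (ZQ ^+ (v * (2 * phi (tau g) (tau h))) = ZQ ^+ (2 * phi (tau (s g)) (tau (s h))))%g.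
  apply: (mulIg (s h * s g)%g); rewrite -pauli_swap expgM -vE -sX // -!sM ?groupM ?groupX //.
  by rewrite -pauli_swap.
move/(congr1 (fun q => pauli_op q (tensor_basis C 0) 0)); rewrite !pauli_opZ !ffunE eqxx.
rewrite ![_ *: 1]mulr1 mulnCA !(exprM zeta 2) => /eqP.
rewrite (eq_prim_root_expr (xi_prim zetaP)) -!(Zmod_nat d_gt0).
by rewrite natrM !(natr_Zmod d_gt0) mulr_natl => /eqP/val_inj.
Qed.

(** The image of [g] is a scalar, hence a power of the image of [zeta]; so [g] lies in [H] up to a
    power of [zeta]. *)
Lemma quotient_pauli_lagrangian g (e f : 'I_m -> P) :
    (forall r, e r \in 'N(H)%g /\ s (e r) = pauliZ zetaP r) ->
    (forall r, f r \in 'N(H)%g /\ s (f r) = pauliX zetaP r) ->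
    g \in 'N(H)%g ->
    (forall r, phi (tau g) (tau (e r)) = 0 /\ phi (tau g) (tau (f r)) = 0) ->
  tau g \in tau_set H.
Proof.
move=> eP fP gN gef.
have : s g \in <[s ZP]>%g.
  rewrite quotient_pauli_zeta -tau_ker; apply/eqP/tau_quotient_pauli_eq0 => // r.
    by have [eN er] := eP r; exists (e r); rewrite // (gef r).1.
  by have [fN fr] := fP r; exists (f r); rewrite // (gef r).2.
case/cycleP => c; rewrite -sX ?zeta_norm // => /s_inj[] //; rewrite ?groupX ?zeta_norm //.
by move=> k kH ->; rewrite tauM tau_zetaX addr0 imset_f.
Qed.

End QuotientIsPauli.

Section QuotientShiftedFree.
Variables (C : numClosedFieldType) (d : nat) (zeta : C).
Hypothesis zetaP : (dbar d).-primitive_root zeta.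
Variables (n k : nat) (le_kn : (k <= n)%N).
Local Notation P := (pauli zetaP n).
Local Notation F := 'rV[Zmod d]_(n + n).
Variable H : {group P}.
Hypotheses (abH : abelian H) (sfH : scalar_free H).

Let d_gt0 : (0 < d)%N := d_gt0 zetaP.

Lemma phi_std_basis m (r r' : 'I_m) :
  [/\ phi (tau (pauliZ zetaP r)) (tau (pauliZ zetaP r')) = 0,
      phi (tau (pauliX zetaP r)) (tau (pauliX zetaP r')) = 0
    & phi (tau (pauliZ zetaP r)) (tau (pauliX zetaP r')) = (r == r')%:R].
Proof.
by rewrite !tauX !tauZ !phi_zl phi_xl !row_mxEl !row_mxEr !mxE oppr0 eqxx andTb eq_sym.
Qed.

Lemma quotient_pauli_adapted_basis :
    ('N(H) / H \isog [set: pauli zetaP (n - k)])%g ->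
  exists e f a, symplectic_from 0 e f /\ adapted (tau_group H) k 0 e f a.
Proof.
case/isogP => sigma sigma_inj sigma_im.
have [v phiv] := quotient_pauli_scale sfH sigma_inj sigma_im.
have [rho rhoN rhoE] := fin_all_exists2 (quotient_pauli_lift sigma_im).
(* The generator of index [r] is placed at index [r + k]; below [k] the subtraction truncates and
   the values serve as fillers. *)
pose zz (i : 'I_n) : pauli zetaP (n - k) :=
  if insub (i - k)%N is Some r then pauliZ zetaP r else 1%g.
pose xx (i : 'I_n) : pauli zetaP (n - k) :=
  if insub (i - k)%N is Some r then pauliX zetaP r else 1%g.
have upper (i : 'I_n) : (k <= i)%N -> exists r : 'I_(n - k),
    [/\ r = i - k :> nat, zz i = pauliZ zetaP r & xx i = pauliX zetaP r]%N.
  move=> ki; have lt_i : (i - k < n - k)%N by rewrite ltn_sub2r // (leq_ltn_trans ki).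
  by exists (Ordinal lt_i); rewrite /zz /xx insubT.
(* The factor [v] compensates the scaling of [phi], so that [phi (e i) (f i) = 1]. *)
pose e i := tau (rho (zz i)); pose f i := tau (rho (xx i)) *+ v.
have phi_rho0 q q' : phi (tau q) (tau q') = 0 -> phi (tau (rho q)) (tau (rho q')) = 0.
  move=> qq; apply/eqP; rewrite (quotient_pauli_commute sfH sigma_inj) //.
  by rewrite !rhoE qq.
apply: (@adapted_basis d n d_gt0 (tau_group H) k _ e f) => //.
- exact: tau_set_isotropic.
- move=> i j ki kj; have [r [rE zi xi]] := upper i ki; have [r' [rE' zj xj]] := upper j kj.
  have [std1 std2 std3] := phi_std_basis r r'.
  rewrite /e /f zi xi zj xj !phiMnr phiMnl (phiv (rho (pauliZ zetaP r))) //.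
  rewrite !rhoE std3 !phi_rho0 // ?mul0rn.
  split=> //; congr (_ %:R).
  by rewrite -val_eqE /= rE rE' -(eqn_add2r k) !subnK.
- move=> i ki x xH; rewrite /e /f phiMnr.
  have orth q : phi x (tau (rho q)) = 0.
    by rewrite phi_skew (normaliserP sfH _ (rhoN q)) ?oppr0.
  by rewrite !orth mul0rn.
move=> x xL xef; have [g gx] := tau_surj zetaP x.
rewrite -gx.
have gN : g \in 'N(H)%g by apply/(normaliserP sfH) => y yH; rewrite gx xL.
pose lft (r : 'I_(n - k)) : 'I_n := cast_ord (subnKC le_kn) (rshift k r).
have lftE r : zz (lft r) = pauliZ zetaP r /\ xx (lft r) = pauliX zetaP r.
  have [|r' [r'E -> ->]] := upper (lft r); first exact: leq_addr.
  by rewrite (_ : r' = r) //; apply: val_inj; rewrite /= r'E /= addKn.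
apply: (quotient_pauli_lagrangian sfH sigma_inj sigma_im
         (e := fun r => rho (pauliZ zetaP r)) (f := fun r => rho (pauliX zetaP r))) => // r.
have [zr xr] := lftE r; have [|x1 x2] := perpP _ _ _ _ xef (lft r); first exact: leq_addr.
rewrite -zr -xr; split; first by rewrite gx.
(* The product of the images is [v] times the product with the unscaled preimage, that is, the
   product with [f], which vanishes. *)
apply/eqP; rewrite (quotient_pauli_commute sfH sigma_inj) // -phiv // gx.
by rewrite -phiMnr -/(f _) x2.
Qed.

(** Lift an adapted basis with the prescribed powers in [H]. These powers generate [K] inside [H];
    the basis is adapted to [tau(K)] as well, so [tau(K)] contains [tau(H)], and [tau] is injective
    on [H]. *)
Lemma quotient_pauli_is_shift :
    ('N(H) / H \isog [set: pauli zetaP (n - k)])%g ->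
  exists H' : {group P},
    [/\ abelian H', scalar_free H', (H' \isog [set: 'rV[Zmod d]_k])%g & is_shift le_kn H' H].
Proof.
case/quotient_pauli_adapted_basis => e [f [a [ef efa]]].
pose w := widen_ord le_kn.
have w_inj : injective w by move=> i j /(congr1 val) /= ij; apply: val_inj.
have iw (i : 'I_k) : (w i < k)%N by exact: (ltn_ord i).
have aP (i : 'I_k) : [/\ (a (w i) %| d)%N, e (w i) *+ a (w i) \in tau_group H
                       & f (w i) *+ (d %/ a (w i))%N \in tau_group H].
  by have := efa (w i) (leq0n _); rewrite iw.
have lift_ex (u : 'I_n -> F) (b : 'I_n -> nat) :
    (forall i : 'I_k, (b (w i) %| d)%N /\ u (w i) *+ b (w i) \in tau_group H) ->
  exists g : 'I_n -> P, forall i, [/\ tau (g i) = u i, (g i ^+ d = 1)%g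
    & (i < k)%N -> (g i ^+ b i)%g \in H].
  move=> bP; suff ex i : exists g, [/\ tau g = u i, (g ^+ d = 1)%g
    & (i < k)%N -> (g ^+ b i)%g \in H] by have [g gP] := fin_all_exists ex; exists g.
  have [ik|ki] := ltnP i k.
    have := bP (Ordinal ik); rewrite (_ : w _ = i) => [[bd ub]|]; last exact: val_inj.
    by have [g [gu gd gb]] := lift_of_order_d sfH bd ub; exists g.
  have [||g [gu gd _]] := lift_of_order_d (u := u i) (b := d) sfH _ _; first exact: dvdnn.
    by rewrite mulrn_row //; exact: (group1 (tau_group H)).
  by exists g.
have [i|Z' Z'P] := lift_ex e a; first by have [ad ea _] := aP i.
have [i|X' X'P] := lift_ex f (fun i => d %/ a i)%N.
  by have [ad _ fa] := aP i; rewrite dvdn_div.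
have Z'd i : (Z' i ^+ d = 1)%g by have [] := Z'P i.
have tZ' i : tau (Z' i) = e i by have [] := Z'P i.
have tX' i : tau (X' i) = f i by have [] := X'P i.
have one_tors c : (1 : Zmod d) *+ c = 0 -> (d %| c)%N by move/eqP; rewrite Zmod_nat_eq0.
(* A vector with a partner of product [1] has order [d], which bounds the order of its lift from
   below. *)
have ordE (g : P) u v : tau g = u -> (g ^+ d = 1)%g -> phi u v = 1 -> #[g]%g = d.
  move=> gu gd uv; apply/eqP; rewrite eqn_dvd order_dvdn gd eqxx /=; apply: one_tors.
  by rewrite -uv -phiMnl -gu -tauX_nat expg_order tau1 phi0l.
have Z'C i j : commute (Z' (w i)) (Z' (w j)).
  by apply/pauli_commuteP; rewrite !tZ'; have [-> _ _] := ef (w i) (w j) (leq0n _) (leq0n _).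
pose Hp := (pow_prod_morphism Z'C (fun i => Z'd (w i)) @* [set: 'rV[Zmod d]_k])%G.
have tpow t : tau (pow_prod (Z' \o w) t) = \sum_i t 0 i *: e (w i).
  by rewrite tau_pow_prod; apply: eq_bigr => i _; rewrite /= tZ'.
have HpE : Hp :=: <<[set Z' (w i) | i : 'I_k]>>%g by exact: pow_prod_gen.
have tpow_inj (t : 'rV[Zmod d]_k) : \sum_i t 0 i *: e (w i) = 0 -> t = 0.
  move=> t0; have [_ inj] := is_basis_sub ef w_inj (erefl _).
  pose c (s : 'rV[Zmod d]_k) := [ffun i => s 0 i].
  have /inj/ffunP tc : \sum_i c t i *: (e \o w) i = \sum_i c 0 i *: (e \o w) i.
    under eq_bigr do rewrite ffunE; under [RHS]eq_bigr do rewrite ffunE mxE scale0r.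
    by rewrite t0 big1.
  by apply/rowP => i; have := tc i; rewrite !ffunE.
exists Hp; split.
- by apply: morphim_abelian; exact: zmod_abelian.
- apply/setP => x; rewrite inE; apply/andP/set1gP => [[]|->]; last by rewrite !group1.
  case/morphimP => t _ _ -> /=; rewrite -tau_ker tpow => /eqP/tpow_inj ->.
  exact: pow_prod0.
- rewrite isog_sym; apply/isogP; eexists; last reflexivity.
  apply/injmP => s t _ _ /(congr1 (@tau _ _ _ zetaP n)) /= /eqP.
  rewrite !tpow -subr_eq0 -sumrB => /eqP st; apply/eqP; rewrite -subr_eq0; apply/eqP.
  by apply: tpow_inj; rewrite -[RHS]st; apply: eq_bigr => i _; rewrite !mxE scalerBl.
exists e, f, Z', X', (a \o w); split.
- split; first exact: symplectic_from0_basis.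
  apply: (is_basis_sub ef w_inj); apply/setP => x.
  apply/imsetP/imsetP => [[g /morphimP[t _ _ ->] ->]|[c _ ->]].
    exists [ffun i => t 0 i] => //=; rewrite tpow.
    by apply: eq_bigr => i _; rewrite ffunE.
  exists (pow_prod (Z' \o w) (\row_i c i)).
    by apply/morphimP; exists (\row_i c i); rewrite ?inE.
  by rewrite tpow; apply: eq_bigr => i _; rewrite mxE.
- move=> i; have [_ _ ef1] := ef i i (leq0n _) (leq0n _); rewrite eqxx in ef1.
  have [_ Xd _] := X'P i; split=> //; first exact: ordE (tZ' i) (Z'd i) ef1.
  apply: (ordE _ _ (- e i) (tX' i) Xd).
  by rewrite phiNr phi_skew opprK.
- exact: HpE.
- by move=> i; have [ad _ _] := aP i; rewrite /= ad (dvdn_gt0 d_gt0 ad).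
set gens := (_ :|: _); pose K := <<gens>>%G.
have KH : K \subset H.
  rewrite gen_subG; apply/subUsetP; split; apply/subsetP => _ /imsetP[i _ ->] /=.
    by have [_ _ ->] := Z'P (w i).
  by have [_ _ ->] := X'P (w i).
apply/eqP; rewrite eqEsubset KH andbT; apply/subsetP => h hH.
have Kiso y : y \in tau_set K -> phi (tau h) y = 0.
  by case/imsetP => g /(subsetP KH) gH ->; apply: (tau_set_isotropic abH); exact: imset_f.
have efK : adapted (tau_group K) k 0 e f a.
  move=> i _; have := efa i (leq0n _); case: ifP => [ik [ad _ _]|_ perp x].
    have wi : w (Ordinal ik) = i by exact: val_inj.
    split=> //.
      rewrite -tZ' -tauX_nat; apply/imset_f/mem_gen/setUP; left; apply/imsetP.
      by exists (Ordinal ik); rewrite ?inE // -[widen_ord _ _]/(w _) /= wi.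
    rewrite -tX' -tauX_nat; apply/imset_f/mem_gen/setUP; right; apply/imsetP.
    by exists (Ordinal ik); rewrite ?inE // -[widen_ord _ _]/(w _) /= wi.
  by case/imsetP => g /(subsetP KH) gH ->; apply: perp; exact: imset_f.
have /imsetP[g gK hg] : tau h \in tau_group K.
  apply: (adapted_lagrangian d_gt0 ef efK) => //; apply/perpP => i ki.
  have := efa i (leq0n _); rewrite ltnNge ki; apply; exact: imset_f.
by rewrite (tau_inj_in sfH hH (subsetP KH g gK) hg).
Qed.

End QuotientShiftedFree.

(** * The action on the stabilised space *)

Section HermitianProduct.
Variables (C : numClosedFieldType) (d n : nat).
Local Notation V := (qudits C d n).
Implicit Types (u v : V) (c : C).

Lemma hdotDl u u' v : hdot (u + u') v = hdot u v + hdot u' v.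
Proof. by rewrite /hdot -big_split; apply: eq_bigr => t _; rewrite !ffunE mulrDl. Qed.

Lemma hdotZl c u v : hdot (c *: u) v = c * hdot u v.
Proof.
rewrite /hdot mulr_sumr; apply: eq_bigr => t _.
by rewrite !ffunE -[c *: _]/(c * _) mulrA.
Qed.

Lemma hdotC u v : hdot u v = (hdot v u)^*.
Proof.
rewrite /hdot rmorph_sum /=; apply: eq_bigr => t _.
by rewrite rmorphM /= conjCK mulrC.
Qed.

Lemma hdotZr c u v : hdot u (c *: v) = c^* * hdot u v.
Proof. by rewrite hdotC hdotZl rmorphM /= -hdotC. Qed.

Lemma hdot0l v : hdot 0 v = 0.
Proof. by rewrite -(scale0r (0 : V)) hdotZl mul0r. Qed.

Lemma hdot_suml (I : finType) (G : I -> V) v : hdot (\sum_i G i) v = \sum_i hdot (G i) v.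
Proof. exact: (big_morph (fun u => hdot u v) (fun u u' => hdotDl u u' v) (hdot0l v)). Qed.

Lemma hdot_sumr (I : finType) (G : I -> V) v : hdot v (\sum_i G i) = \sum_i hdot v (G i).
Proof. by rewrite hdotC hdot_suml rmorph_sum /=; apply: eq_bigr => i _; rewrite -hdotC. Qed.

Lemma hdot_gt0 v : v != 0 -> 0 < hdot v v.
Proof.
move=> v0; have [t vt] : exists t, v t != 0.
  apply/existsP; apply: contraNT v0 => /existsPn v0; apply/eqP/ffunP => t.
  by rewrite ffunE; apply/eqP; rewrite -[_ == _]negbK v0.
rewrite /hdot (bigD1 t) //= ltr_pwDl ?mul_conjC_gt0 // sumr_ge0 // => s _.
exact: mul_conjC_ge0.
Qed.

End HermitianProduct.

Section WeylOperators.
Variables (C : numClosedFieldType) (d : nat) (zeta : C).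
Hypothesis zetaP : (dbar d).-primitive_root zeta.
Variable n : nat.
Local Notation P := (pauli zetaP n).
Local Notation V := (qudits C d n).
Local Notation T := 'rV[Zmod d]_n.
Implicit Types (g h : P) (u v : V) (s t b : T).

Let d_gt0 : (0 < d)%N := d_gt0 zetaP.

Lemma norm_xi_pow (x : Zmod d) : `|xi_pow zeta x| = 1.
Proof. by rewrite !normrX (norm_zeta zetaP) !expr1n. Qed.

Lemma conj_xi_pow (x : Zmod d) : (xi_pow zeta x)^* = (xi_pow zeta x)^-1.
Proof.
apply: (mulfI (xi_pow_neq0 zetaP x)).
by rewrite -normCK norm_xi_pow expr1n divff ?xi_pow_neq0.
Qed.

(** Orthogonality of characters: translating by a basis vector multiplies the sum by [xi ^ (b_r)],
    which differs from [1] for some [r] when [b] is nonzero. *)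
Lemma chi_sum b : \sum_t chi zeta b t = #|T|%:R * (b == 0)%:R.
Proof.
case: eqVneq => [->|b0].
  rewrite mulr1 -sumr_const; apply: eq_bigr => t _; by rewrite chiC chi0.
have [r br] : exists r, b 0 r != 0.
  apply/existsP; apply: contraNT b0 => /existsPn b0; apply/eqP/rowP => r.
  by rewrite mxE; apply/eqP; rewrite -[_ == _]negbK b0.
rewrite mulr0; set S := (X in X = 0).
have : S = xi_pow zeta (b 0 r) * S.
  rewrite {1}/S (reindex_inj (addIr (delta_mx 0 r))) /= /S mulr_sumr.
  by apply: eq_bigr => t _; rewrite (chiDr zetaP) (chi_delta zetaP) mulrC.
move/eqP; rewrite -{1}[S]mul1r -subr_eq0 -mulrBl mulf_eq0 subr_eq0 eq_sym.
by rewrite (xi_pow_eq1 zetaP) (negPf br) => /eqP.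
Qed.

(** A nonzero [X] part leaves no diagonal entry; otherwise the diagonal is a character sum. *)
Lemma pauli_trace g :
  \sum_t pauli_op g (tensor_basis C t) t = #|T|%:R * phase g * (tau g == 0)%:R :> C.
Proof.
have opE t : pauli_op g (tensor_basis C t) t =
    phase g * chi zeta (zpart g) t * (xpart g == 0)%:R :> C.
  rewrite pauli_opE !ffunE -[LHS]/(_ * _ : C); congr (_ * _%:R).
  by rewrite -{1}(addr0 t) (inj_eq (addrI t)) eq_sym.
under eq_bigr do rewrite opE.
rewrite -mulr_suml -mulr_sumr chi_sum tauE.
rewrite (_ : (row_mx (zpart g) (xpart g) == 0) = (zpart g == 0) && (xpart g == 0)).
  by rewrite -mulnb natrM; ring.
rewrite -row_mx0; apply/eqP/andP => [/eq_row_mx[-> ->]|[/eqP-> /eqP->]] //.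
Qed.

(* Resolution of the identity: the Weyl operators average a rank one operator
   to a scalar. *)
Lemma weyl_resolution (G : T * T -> P) u v :
    (forall p, tau (G p) = row_mx p.1 p.2) ->
  \sum_p hdot v (pauli_op (G p) u) *: pauli_op (G p) u = (#|T|%:R * hdot u u) *: v.
Proof.
move=> GP; have zG p : zpart (G p) = p.1 by have := GP p; rewrite tauE => /eq_row_mx[].
have xG p : xpart (G p) = p.2 by have := GP p; rewrite tauE => /eq_row_mx[].
apply/ffunP => s; rewrite sum_ffunE !ffunE.
have term p : (hdot v (pauli_op (G p) u) *: pauli_op (G p) u) s =
    \sum_s' v s' * ((u (s' - p.2))^* * u (s - p.2)) * chi zeta (s - s') p.1 :> C.
  rewrite ffunE -[LHS]/(_ * _ : C) /hdot mulr_suml; apply: eq_bigr => s' _.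
  rewrite !pauli_coord zG xG !rmorphM /= -[chi zeta _ (s - p.2)]mulr1.
  have n1 : chi zeta p.1 (s - p.2) * (chi zeta p.1 (s' - p.2))^* = chi zeta (s - s') p.1.
    rewrite !(chi_dot zetaP) conj_xi_pow -(xi_powN zetaP) -(xi_powD zetaP); congr xi_pow.
    rewrite -sumrN -big_split; apply: eq_bigr => r _; rewrite !mxE /=; ring.
  have n2 : phase (G p) * (phase (G p))^* = 1 by rewrite -normCK norm_phase expr1n.
  rewrite -n1 mulr1; set c := phase _ in n2 *.
  transitivity (c * c^* * (v s' * ((u (s' - p.2))^* * u (s - p.2)) *
     (chi zeta p.1 (s - p.2) * (chi zeta p.1 (s' - p.2))^*))); last by rewrite n2 mul1r.
  by ring.
under eq_bigr do rewrite term.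
rewrite -(pair_bigA _ (fun b a =>
  \sum_s' v s' * ((u (s' - a))^* * u (s - a)) * chi zeta (s - s') b)) /=.
rewrite exchange_big /=; under eq_bigr do rewrite exchange_big /=.
(* Summing over the [Z] part leaves only [s' = s], by orthogonality of characters. *)
transitivity (\sum_a #|T|%:R * v s * ((u (s - a))^* * u (s - a))).
  apply: eq_bigr => a _; rewrite (bigD1 s) //= [X in _ + X]big1 ?addr0 => [|s' ns].
    by rewrite -mulr_sumr chi_sum subrr eqxx mulr1; ring.
  by rewrite -mulr_sumr chi_sum subr_eq0 eq_sym (negPf ns) !mulr0.
rewrite -mulr_sumr -[RHS]/(_ * _ : C) [RHS]mulrAC; congr (_ * _).
rewrite /hdot [RHS](reindex_inj (inj_comp (addrI s) oppr_inj)) /=.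
by apply: eq_bigr => t _; rewrite mulrC.
Qed.

End WeylOperators.

(** * An orthonormal basis of [V^H] on which [N(H)] acts by standard operators *)

Section StabilisedSpace.
Variables (C : numClosedFieldType) (d : nat) (zeta : C).
Hypothesis zetaP : (dbar d).-primitive_root zeta.
Variables (n m : nat).
Local Notation P := (pauli zetaP n).
Local Notation Q := (pauli zetaP m).
Local Notation V := (qudits C d n).
Local Notation T := 'rV[Zmod d]_m.
Local Notation Z := (pauli_zeta zetaP n).
Variable H : {group P}.
Hypothesis sfH : scalar_free H.
Variables (zl xl : 'I_m -> P).
Hypotheses (zlN : forall r, zl r \in 'N(H)%g) (xlN : forall r, xl r \in 'N(H)%g).
Hypotheses (zl_d : forall r, (zl r ^+ d = 1)%g) (xl_d : forall r, (xl r ^+ d = 1)%g).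
Hypothesis zxl : forall r s, [/\ phi (tau (zl r)) (tau (zl s)) = 0,
  phi (tau (xl r)) (tau (xl s)) = 0 & phi (tau (zl r)) (tau (xl s)) = (r == s)%:R].
Hypothesis zxl_span : forall g, g \in 'N(H)%g -> exists (b t : T),
  tau g - \sum_r b 0 r *: tau (zl r) - \sum_r t 0 r *: tau (xl r) \in tau_set H.
Implicit Types (g h : P) (u v : V) (s t b : T) (y : qudits C d m).

Let d_gt0 : (0 < d)%N := d_gt0 zetaP.

Let zl_comm (r s : 'I_m) : commute (zl r) (zl s).
Proof. by apply/pauli_commuteP; have [-> _ _] := zxl r s. Qed.
Let xl_comm (r s : 'I_m) : commute (xl r) (xl s).
Proof. by apply/pauli_commuteP; have [_ -> _] := zxl r s. Qed.
Let zp b : P := pow_prod zl b.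
Let xp t : P := pow_prod xl t.

Let stab_comm g h : g \in 'N(H)%g -> h \in H -> commute g h.
Proof. by rewrite normaliser_centraliser // => /centP gH /gH. Qed.

Let zpN b : zp b \in 'N(H)%g.
Proof. by apply: group_prod => r _; rewrite groupX. Qed.
Let xpN t : xp t \in 'N(H)%g.
Proof. by apply: group_prod => r _; rewrite groupX. Qed.

Lemma phi_zp_xl b r : phi (tau (zp b)) (tau (xl r)) = b 0 r.
Proof.
rewrite tau_pow_prod phi_suml (bigD1 r) //= big1 ?addr0 => [|s /negPf sr]; rewrite phiZl.
  by have [_ _ ->] := zxl r r; rewrite eqxx mulr1.
by have [_ _ ->] := zxl s r; rewrite sr mulr0.
Qed.

Lemma phi_zl_xp t r : phi (tau (zl r)) (tau (xp t)) = t 0 r.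
Proof.
rewrite phi_skew tau_pow_prod phi_suml (bigD1 r) //= big1 ?addr0 => [|s /negPf sr].
  by rewrite phiZl phi_skew; have [_ _ ->] := zxl r r; rewrite eqxx mulrN1 opprK.
by rewrite phiZl phi_skew; have [_ _ ->] := zxl r s; rewrite eq_sym sr oppr0 mulr0.
Qed.

Lemma stabiliser_zp_scalar h b : h \in H -> tau (h * zp b)%g = 0 -> h = 1%g /\ b = 0.
Proof.
move=> hH; rewrite tauM => hb.
have b0 : b = 0.
  apply/rowP => r; rewrite mxE -phi_zp_xl -[RHS](phi0l (tau (xl r))) -hb phiDl.
  rewrite (_ : phi (tau h) _ = 0) ?add0r //; apply/eqP/pauli_commuteP.
  exact/commute_sym/stab_comm.
split=> //; apply: (scalar_free1 sfH hH).
by move: hb; rewrite b0 /zp pow_prod0 // tau1 addr0.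
Qed.

(** Sum the operators of the group generated by [H] and the [zl r]. Only the identity has a nonzero
    trace, so the sum is nonzero on some basis vector, and its values are fixed. *)
Lemma stabilised_vector : exists v0 : V, [/\ hdot v0 v0 = 1,
  forall h, h \in H -> pauli_op h v0 = v0 & forall b, pauli_op (zp b) v0 = v0].
Proof.
pose avg (t : 'rV[Zmod d]_n) : V := \sum_(h in H) \sum_b pauli_op (h * zp b)%g (tensor_basis C t).
have avg_tr : \sum_t avg t t = #|'rV[Zmod d]_n|%:R :> C.
  transitivity (\sum_(h in H) \sum_b \sum_t pauli_op (h * zp b)%g (tensor_basis C t) t : C).
    under eq_bigr do rewrite sum_ffunE; rewrite exchange_big /=; apply: eq_bigr => h _.
    under eq_bigr do rewrite sum_ffunE; by rewrite exchange_big.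
  rewrite (bigD1 1%g) //= [X in _ + X]big1 ?addr0 => [|h /andP[hH h1]].
    rewrite (bigD1 0) //= [X in _ + X]big1 ?addr0 => [|b b0].
      rewrite /zp pow_prod0 // mulg1; under eq_bigr do rewrite pauli_op1 id_lfunE ffunE eqxx.
      by rewrite sumr_const.
    rewrite pauli_trace; case: eqVneq => [/stabiliser_zp_scalar[//|_ bb]|_]; last by rewrite mulr0.
    by rewrite bb eqxx in b0.
  apply: big1 => b _; rewrite pauli_trace.
  case: eqVneq => [/stabiliser_zp_scalar[//|hh _]|_]; last by rewrite mulr0.
  by rewrite hh eqxx in h1.
have [t vt] : exists t : 'rV[Zmod d]_n, avg t != 0.
  apply/existsP; apply: contraT => /existsPn avg0.
  have /eqP := avg_tr; rewrite big1 => [|t _].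
    by rewrite eq_sym pnatr_eq0 card_mx card_ord expn_eq0.
  by have := avg0 t; rewrite negbK => /eqP ->; rewrite ffunE.
set v := avg t in vt.
have Hv h : h \in H -> pauli_op h v = v.
  move=> hH; rewrite /v /avg linear_sum /= [RHS](reindex_inj (mulgI h)) /=.
  apply: eq_big => [h'|h' _]; first by rewrite groupMl.
  rewrite linear_sum; apply: eq_bigr => b _ /=.
  by rewrite -mulgA [in RHS]pauli_opM comp_lfunE.
have Zv b : pauli_op (zp b) v = v.
  rewrite /v /avg linear_sum /=; apply: eq_bigr => h hH.
  rewrite linear_sum /= [RHS](reindex_inj (addrI b)) /=; apply: eq_bigr => b' _.
  rewrite -comp_lfunE -pauli_opM /zp pow_prodD // !mulgA.
  by rewrite (stab_comm (zpN b) hH).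
pose c := (sqrtC (hdot v v))^-1; exists (c *: v); split.
- have v_gt0 := hdot_gt0 vt.
  rewrite hdotZl hdotZr mulrA -normCK /c normfV ger0_norm ?sqrtC_ge0 ?ltW //.
  by rewrite exprVn sqrtCK mulVf ?gt_eqF.
- by move=> h hH; rewrite linearZ /= Hv.
- by move=> b; rewrite linearZ /= Zv.
Qed.

(** [zxl_span] gives the decomposition under [tau], and lifts agree up to a power of [zeta]. The
    exponents are read off by products with [xl] and [zl]. *)
Lemma normaliser_decomp g : g \in 'N(H)%g -> exists b t h c,
  [/\ h \in H, g = (xp t * zp b * h * Z ^+ c)%g,
      forall r, phi (tau g) (tau (xl r)) = b 0 r
    & forall r, phi (tau (zl r)) (tau g) = t 0 r].
Proof.
move=> gN; have [b [t /imsetP[h hH hE]]] := zxl_span gN.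
have gE : tau g = tau (xp t * zp b * h)%g.
  rewrite !tauM -hE !tau_pow_prod [RHS]addrC [RHS]addrA.
  by rewrite !subrK.
have /tau_eqP[c gc] := introT eqP gE.
have Hx r : phi (tau h) (tau (xl r)) = 0.
  by apply/eqP/pauli_commuteP/commute_sym/stab_comm.
have Hz r : phi (tau (zl r)) (tau h) = 0 by apply/eqP/pauli_commuteP/stab_comm.
exists b, t, h, c; split=> // r; rewrite gE !tauM.
  rewrite !phiDl phi_zp_xl Hx addr0 tau_pow_prod phi_suml big1 ?add0r // => s _.
  by rewrite phiZl; have [_ -> _] := zxl s r; rewrite mulr0.
rewrite !phiDr phi_zl_xp Hz addr0 [X in _ + X](_ : _ = 0) ?addr0 //.
rewrite phi_skew tau_pow_prod phi_suml big1 ?oppr0 // => s _.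
by rewrite phiZl; have [-> _ _] := zxl s r; rewrite mulr0.
Qed.

Section Frame.
Variable v0 : V.
Hypotheses (v0_norm : hdot v0 v0 = 1) (v0H : forall h, h \in H -> pauli_op h v0 = v0).
Hypothesis v0z : forall b, pauli_op (zp b) v0 = v0.

Definition frame t : V := pauli_op (xp t) v0.
(** This will be the isometry from [(C^d)^m] onto [V^H], with [frame t] in the role of [v_t]. *)
Definition synth y : V := \sum_t (y t : C) *: frame t.

Fact synth_linear : linear synth.
Proof.
move=> c y y'; rewrite /synth scaler_sumr -big_split /=.
by apply: eq_bigr => t _; rewrite !ffunE scalerDl scalerA.
Qed.
HB.instance Definition _ :=
  GRing.isLinear.Build C (qudits C d m) (qudits C d n) _ synth synth_linear.

Lemma synth_basis t : synth (tensor_basis C t) = frame t.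
Proof.
rewrite /synth (bigD1 t) //= big1 ?addr0 => [|s /negPf st].
  by rewrite ffunE eqxx scale1r.
by rewrite ffunE st scale0r.
Qed.

Lemma zl_frame r t :
  pauli_op (zl r) (frame t) = xi_pow zeta (t 0 r) *: frame t.
Proof.
rewrite /frame -comp_lfunE -pauli_opM pauli_op_swap pauli_opM comp_lfunE phi_zl_xp.
by rewrite -{2}(v0z (delta_mx 0 r)) /zp pow_prod_delta.
Qed.

Lemma xl_frame r t : pauli_op (xl r) (frame t) = frame (t + delta_mx 0 r).
Proof.
rewrite /frame -comp_lfunE -pauli_opM addrC /xp pow_prodD //.
by rewrite pow_prod_delta.
Qed.

Lemma frame_fix t h : h \in H -> pauli_op h (frame t) = frame t.
Proof.
move=> hH; rewrite /frame -comp_lfunE -pauli_opM -(stab_comm (xpN t) hH).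
by rewrite pauli_opM comp_lfunE v0H.
Qed.

(** Distinct frame vectors have distinct eigenvalues under some unitary [zl r]. *)
Lemma frame_orthonormal s t : hdot (frame s) (frame t) = (s == t)%:R.
Proof.
case: eqVneq => [->|st]; first by rewrite /frame hdot_pauli.
have [r str] : exists r, s 0 r != t 0 r.
  apply/existsP; apply: contraNT st => /existsPn st; apply/eqP/rowP => r.
  by apply/eqP; rewrite -[_ == _]negbK st.
have := hdot_pauli (zl r) (frame s) (frame t).
rewrite !zl_frame hdotZl hdotZr mulrA conj_xi_pow // -xi_powN // -xi_powD // => /eqP.
rewrite -subr_eq0 -{2}[hdot _ _]mul1r -mulrBl mulf_eq0 subr_eq0 xi_pow_eq1 // subr_eq0.
by rewrite (negPf str) => /eqP.
Qed.

Lemma hdot_synth y t : hdot (synth y) (frame t) = y t.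
Proof.
rewrite /synth hdot_suml (bigD1 t) //= big1 ?addr0 => [|s /negPf st].
  by rewrite hdotZl frame_orthonormal eqxx mulr1.
by rewrite hdotZl frame_orthonormal st mulr0.
Qed.

Lemma synth_inj : injective synth.
Proof. by move=> y y' yy; apply/ffunP => t; rewrite -!hdot_synth yy. Qed.

Lemma synth_fix y h : h \in H -> pauli_op h (synth y) = synth y.
Proof.
move=> hH; rewrite /synth linear_sum; apply: eq_bigr => t _.
by rewrite linearZ /= frame_fix.
Qed.

(** The Weyl resolution at [v0] writes [v] in terms of the [pauli_op g v0]. A nonzero coefficient
    forces [g] into [N(H)], and then [pauli_op g v0] is a multiple of a frame vector. *)
Lemma frame_expansion v : (forall h, h \in H -> pauli_op h v = v) ->
  v = synth [ffun t => hdot v (frame t)].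
Proof.
move=> vH; pose ex (u : V) := synth [ffun t => hdot u (frame t)].
rewrite -/(ex v).
have exZ c u : ex u = u -> ex (c *: u) = c *: u.
  move=> uE; rewrite -{2}uE -linearZ /= /ex; congr synth; apply/ffunP => t.
  by rewrite !ffunE hdotZl.
have exD u u' : ex u = u -> ex u' = u' -> ex (u + u') = u + u'.
  move=> uE uE'; rewrite -{2}uE -{2}uE' -linearD /= /ex; congr synth; apply/ffunP => t.
  by rewrite !ffunE hdotDl.
have ex0 : ex 0 = 0.
  rewrite /ex -[RHS](linear0 synth); congr synth.
  by apply/ffunP => t; rewrite !ffunE hdot0l.
have exframe t : ex (frame t) = frame t.
  rewrite /ex -[RHS]synth_basis; congr synth; apply/ffunP => s.
  by rewrite !ffunE frame_orthonormal eq_sym.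
have [G GP] : exists G : 'rV[Zmod d]_n * 'rV[Zmod d]_n -> P,
    forall p, tau (G p) = row_mx p.1 p.2.
  exact: (fin_all_exists (fun p : 'rV[Zmod d]_n * 'rV[Zmod d]_n =>
            tau_surj zetaP (row_mx p.1 p.2))).
have := weyl_resolution v0 v GP; rewrite v0_norm mulr1 => res.
have card0 : #|'rV[Zmod d]_n|%:R != 0 :> C by rewrite pnatr_eq0 card_mx card_ord expn_eq0.
rewrite -[in LHS](scale1r v) -[in RHS](scale1r v) -(mulVf card0) -scalerA -res.
apply/esym/exZ; apply: (big_ind (fun u => ex u = u)) => [//|//|p _].
have [-> |nz] := eqVneq (hdot v (pauli_op (G p) v0)) 0; first by rewrite scale0r.
(* As [v] and [v0] are fixed by [h], unitarity multiplies the coefficient by a conjugate of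
   [xi_pow (phi (tau h) (tau (G p)))]; a nonzero coefficient makes this factor [1]. *)
apply: (exZ); have GN : G p \in 'N(H)%g.
  apply/(normaliserP sfH) => _ /imsetP[h hH ->]; rewrite phi_skew; apply/eqP.
  rewrite oppr_eq0 -(xi_pow_eq1 zetaP); have := hdot_pauli h v (pauli_op (G p) v0).
  rewrite vH // -comp_lfunE -pauli_opM pauli_op_swap hdotZr pauli_opM comp_lfunE v0H //.
  rewrite -[RHS]mul1r => /(mulIf nz) /(congr1 Num.conj).
  by rewrite conjCK conjC1 => ->.
have [b [t [h [c [hH -> _ _]]]]] := normaliser_decomp GN.
rewrite !pauli_opM !comp_lfunE pauli_opZ !linearZ /= v0H // v0z.
exact/exZ/exframe.
Qed.

Definition intertwined g (q : 'End(qudits C d m)) :=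
  forall y, pauli_op g (synth y) = synth (q y).

Lemma intertwined_basis g (q : 'End(qudits C d m)) :
  (forall t, pauli_op g (frame t) = synth (q (tensor_basis C t))) -> intertwined g q.
Proof.
move=> gq y; rewrite [in RHS](qudits_sum y) (linear_sum q) [RHS]linear_sum linear_sum.
by apply: eq_bigr => t _; rewrite !linearZ /= gq.
Qed.

Lemma intertwinedM g h (q q' : 'End(qudits C d m)) :
  intertwined g q -> intertwined h q' -> intertwined (g * h)%g (q \o q')%VF.
Proof. by move=> gq hq y; rewrite pauli_opM !comp_lfunE hq gq. Qed.

Lemma intertwined1 : intertwined 1%g \1%VF.
Proof. by move=> y; rewrite pauli_op1 !id_lfunE. Qed.

Lemma intertwinedZ r : intertwined (zl r) (pauli_op (pauliZ zetaP r)).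
Proof.
by apply: intertwined_basis => t; rewrite zl_frame pauliZE linearZ /= synth_basis.
Qed.

Lemma intertwinedX r : intertwined (xl r) (pauli_op (pauliX zetaP r)).
Proof. by apply: intertwined_basis => t; rewrite xl_frame pauliXE synth_basis. Qed.

Lemma intertwined_zeta : intertwined Z (pauli_op (pauli_zeta zetaP m)).
Proof. by move=> y; rewrite !pauli_zetaE linearZ. Qed.

Lemma intertwined_lift (q : Q) : exists2 g, g \in 'N(H)%g & intertwined g (pauli_op q).
Proof.
case: q => x; rewrite /pauli_op /= => xgen; move: (xgen) => /asboolP.
elim=> {x xgen} [x [[r ->]|[r ->]|->]||x x' _ [g gN gx] _ [g' gN' gx']|x _ [g gN gx]].
- by exists (xl r); last exact: intertwinedX.
- by exists (zl r); last exact: intertwinedZ.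
- exists Z; last exact: intertwined_zeta.
  exact: zeta_norm.
- by exists 1%g; rewrite ?group1 //; exact: intertwined1.
- by exists (g * g')%g; rewrite ?groupM //; exact: intertwinedM.
exists g^-1%g; rewrite ?groupV // => y.
rewrite -{1}(id_lfunE y) -(lker0_compfV (valP x)) comp_lfunE -gx.
by rewrite -comp_lfunE -pauli_opM mulVg pauli_op1 id_lfunE.
Qed.

Lemma intertwined_ex g : g \in 'N(H)%g -> exists q : Q, intertwined g (pauli_op q).
Proof.
pose E g' := exists q : Q, intertwined g' (pauli_op q).
have E1 : E 1%g by exists 1%g; exact: intertwined1.
have EM g1 g2 : E g1 -> E g2 -> E (g1 * g2)%g.
  by move=> [q1 gq1] [q2 gq2]; exists (q1 * q2)%g; rewrite pauli_opM; exact: intertwinedM.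
have EX g1 k : E g1 -> E (g1 ^+ k)%g.
  by move=> Eg; elim: k => // k IHk; rewrite expgS; exact: EM.
move=> /normaliser_decomp[b [t [h [c [hH -> _ _]]]]]; rewrite -/(E _).
apply: (EM); last by apply: (EX); exists (pauli_zeta zetaP m); exact: intertwined_zeta.
apply: (EM); last by exists 1%g => y; rewrite synth_fix // pauli_op1 id_lfunE.
apply: (EM); apply: (big_ind E) => // r _; apply: (EX).
  by exists (pauliX zetaP r); exact: intertwinedX.
by exists (pauliZ zetaP r); exact: intertwinedZ.
Qed.

Lemma intertwined_uniq g (q q' : Q) :
  intertwined g (pauli_op q) -> intertwined g (pauli_op q') -> q = q'.
Proof.
by move=> gq gq'; apply/pauli_op_inj/lfunP => y; apply: synth_inj; rewrite -gq -gq'.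
Qed.

Lemma frame0_neq0 : frame 0 != 0.
Proof.
apply/eqP => f0; have := frame_orthonormal 0 0.
by rewrite f0 hdot0l eqxx => /esym/eqP; rewrite oner_eq0.
Qed.

(** Acting trivially, [g] commutes with all [zl r] and [xl r], so its decomposition reduces to [h]
    times a power of [zeta], and this power must be [1]. *)
Lemma intertwined_id g : g \in 'N(H)%g -> intertwined g \1%VF -> g \in H.
Proof.
move=> gN g1; have gf t : pauli_op g (frame t) = frame t.
  by rewrite -synth_basis g1 id_lfunE.
(* [g] fixes both [frame 0] and its image by [h], so [g h] and [h g] agree on a vector with nonzero
   image, and the commutation scalar is [1]. *)
have comm0 h : (exists s, pauli_op h (frame 0) = frame s) \/
    (exists c : C, pauli_op h (frame 0) = c *: frame 0) -> phi (tau g) (tau h) = 0.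
  move=> hf; apply/eqP; rewrite -(xi_pow_eq1 zetaP).
  have gh : pauli_op (g * h)%g (frame 0) = pauli_op (h * g)%g (frame 0).
    rewrite !pauli_opM !comp_lfunE gf.
    by case: hf => [[s ->]|[c ->]]; rewrite ?linearZ /= gf.
  have : pauli_op (h * g)%g (frame 0) != 0.
    apply/eqP => hg0; have := hdot_pauli (h * g)%g (frame 0) (frame 0).
    by rewrite hg0 hdot0l frame_orthonormal eqxx => /esym/eqP; rewrite oner_eq0.
  move=> nz; move: gh; rewrite pauli_op_swap -{2}[pauli_op _ _]scale1r => /eqP.
  by rewrite -subr_eq0 -scalerBl scaler_eq0 (negPf nz) orbF subr_eq0.
have [b [t [h [c [hH gE bE tE]]]]] := normaliser_decomp gN.
have b0 : b = 0.
  apply/rowP => r; rewrite -bE mxE; apply: comm0; left; exists (0 + delta_mx 0 r).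
  exact: xl_frame.
have t0 : t = 0.
  apply/rowP => r; rewrite -tE mxE phi_skew comm0 ?oppr0 //; right.
  by exists (xi_pow zeta ((0 : T) 0 r)); exact: zl_frame.
move: gE; rewrite b0 t0 /xp /zp !pow_prod0 // !mul1g => gE.
have : pauli_op g (frame 0) = frame 0 by [].
rewrite gE pauli_opM comp_lfunE pauli_opZ linearZ /= frame_fix // => /eqP.
rewrite -{2}[frame 0]scale1r -subr_eq0 -scalerBl scaler_eq0 (negPf frame0_neq0) orbF.
rewrite subr_eq0 -(prim_order_dvd zetaP) -(order_zeta zetaP n) order_dvdn => /eqP->.
by rewrite mulg1.
Qed.

Definition frame_coord (v : subvs_of (fixV H)) : qudits C d m :=
  [ffun t => hdot (vsval v) (frame t)].

Fact frame_coord_linear : linear frame_coord.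
Proof.
by move=> c u v; apply/ffunP => t; rewrite !ffunE linearP /= hdotDl hdotZl.
Qed.
HB.instance Definition _ :=
  GRing.isLinear.Build C (subvs_of (fixV H)) (qudits C d m) _ frame_coord frame_coord_linear.

(** [U] is the inverse of [synth] on [V^H], and [f] sends a coset to the operator it induces through
    [synth]; this is independent of the representative because [H] fixes the range of [synth]. *)
Lemma stabilised_action : exists (f : {morphism ('N(H) / H)%g >-> Q})
    (U : 'Hom(subvs_of (fixV H), qudits C d m)),
  [/\ isom ('N(H) / H)%g [set: Q] f, unitary_iso U
    & forall (x : coset_of H) (v : subvs_of (fixV H)),
        (x \in 'N(H) / H)%g -> U (quot_act x v) = pauli_op (f x) (U v)].
Proof.
have fex (x : coset_of H) : exists q : Q, forall g, g \in 'N(H)%g -> coset H g = x ->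
    intertwined g (pauli_op q).
  have [g gN ->] := cosetP x; have [q gq] := intertwined_ex gN.
  exists q => g' gN' /(rcoset_kercosetP gN' gN)/rcosetP[h hH ->] y.
  by rewrite pauli_opM comp_lfunE gq synth_fix.
have [f0 f0P] := fin_all_exists fex.
have fE g q : g \in 'N(H)%g -> intertwined g (pauli_op q) -> f0 (coset H g) = q.
  by move=> gN; apply: intertwined_uniq; exact: f0P.
have fM : {in ('N(H) / H)%g &, {morph f0 : x y / (x * y)%g}}.
  move=> x y _ _; have [g gN ->] := cosetP x; have [g' gN' ->] := cosetP y.
  rewrite -morphM //=; apply: fE; rewrite ?groupM // pauli_opM.
  by apply: intertwinedM; exact: f0P.
pose f := Morphism fM.
pose U : 'Hom(subvs_of (fixV H), qudits C d m) := linfun frame_coord.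
have UE (v : subvs_of (fixV H)) t : U v t = hdot (vsval v) (frame t).
  by rewrite lfunE /= ffunE.
have synthU (v : subvs_of (fixV H)) : synth (U v) = vsval v.
  rewrite [RHS]frame_expansion; last exact/fixVP/subvsP.
  by congr synth; apply/ffunP => t; rewrite UE ffunE.
have Usynth (v : subvs_of (fixV H)) y : vsval v = synth y -> U v = y.
  by move=> vy; apply: synth_inj; rewrite synthU.
exists f, U; split.
- apply/isomP; split.
    apply/injmP => x y; have [g gN ->] := cosetP x; have [g' gN' ->] := cosetP y.
    move=> _ _ /= ff; apply/rcoset_kercosetP => //; apply/rcosetP.
    (* Cosets with the same image differ by an element acting trivially, hence lying in [H]. *)
    exists (g * g'^-1)%g; last by rewrite mulgKV.
    apply: intertwined_id; rewrite ?groupM ?groupV // => y0.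
    pose z := pauli_op (f0 (coset H g'))^-1%g y0.
    have -> : y0 = pauli_op (f0 (coset H g')) z.
      by rewrite -comp_lfunE -pauli_opM mulgV pauli_op1 id_lfunE.
    rewrite id_lfunE -{1}(f0P _ g' gN' erefl) -comp_lfunE -pauli_opM mulgKV.
    by rewrite (f0P _ g gN erefl) ff.
  apply/setP => q; rewrite inE; apply/morphimP.
  have [g gN gq] := intertwined_lift q; exists (coset H g); rewrite ?mem_quotient //=.
  by rewrite (fE _ _ gN gq).
- split; last first.
    move=> u v; rewrite -(synthU v) /synth hdot_sumr; apply: eq_bigr => t _.
    by rewrite hdotZr UE mulrC.
  pose W y : subvs_of (fixV H) := vsproj (fixV H) (synth y).
  have WE y : vsval (W y) = synth y by rewrite vsprojK //; apply/fixVP => h; exact: synth_fix.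
  exists W => [v|y]; last exact: Usynth.
  by apply: val_inj; rewrite -[LHS]/(vsval _) WE synthU.
move=> x v; have [g gN ->] := cosetP x; move=> _.
by apply: Usynth; rewrite quot_actE // -synthU (f0P (coset H g)).
Qed.

End Frame.
End StabilisedSpace.

Section ShiftedFreeQuotient.
Variables (C : numClosedFieldType) (d : nat) (zeta : C).
Hypothesis zetaP : (dbar d).-primitive_root zeta.
Variables (n k : nat) (le_kn : (k <= n)%N).
Local Notation P := (pauli zetaP n).
Local Notation Q := (pauli zetaP (n - k)).
Local Notation F := 'rV[Zmod d]_(n + n).
Variable H : {group P}.
Hypothesis sfH : scalar_free H.

Let d_gt0 : (0 < d)%N := d_gt0 zetaP.

Lemma is_shift_adapted (H' : {group P}) : is_shift le_kn H' H ->
  exists e f a, symplectic_from 0 e f /\ adapted (tau_group H) k 0 e f a.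
Proof.
case=> e [f [Z' [X' [a [[[_ ef] _] ZX _ aP HE]]]]].
pose w := widen_ord le_kn.
have tZ i : tau (Z' i) = e i by have [] := ZX i.
have tX i : tau (X' i) = f i by have [] := ZX i.
have far (i : 'I_n) (j : 'I_k) : (k <= i)%N -> (w j == i) = false.
  by move=> ki; apply/eqP => ji; move: ki; rewrite -ji leqNgt /= ltn_ord.
(* The [a j] are given for [j < k] only; [1] fills the other indices. *)
exists e, f, (fun i => if insub (i : nat) is Some j then a j else 1%N).
split=> [i j _ _|i _]; first exact: ef.
have [ik|ki] := ltnP i k.
  rewrite insubT /=; set j : 'I_k := Ordinal ik; have wj : w j = i by exact: val_inj.
  have /andP[a_gt0 ad] := aP j; split=> //.
    rewrite -tZ -tauX_nat; apply: imset_f; rewrite HE; apply/mem_gen/setUP; left.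
    by apply/imsetP; exists j; rewrite // -[widen_ord _ _]/(w _) wj.
  rewrite -tX -tauX_nat; apply: imset_f; rewrite HE; apply/mem_gen/setUP; right.
  by apply/imsetP; exists j; rewrite // -[widen_ord _ _]/(w _) wj.
have cent (g : P) : (forall j, commute (Z' (w j)) g) -> (forall j, commute (X' (w j)) g) ->
    forall h, h \in H -> phi (tau h) (tau g) = 0.
  move=> Zg Xg h hH; apply/eqP/pauli_commuteP.
  suff /subsetP/(_ h hH)/cent1P : H \subset 'C[g]%g by [].
  rewrite HE gen_subG; apply/subUsetP; split; apply/subsetP => _ /imsetP[j _ ->];
    by apply/cent1P/commute_sym/commuteX/commute_sym.
move=> _ /imsetP[h hH ->]; rewrite -tZ -tX; split; apply: cent => // j;
  apply/pauli_commuteP/eqP; rewrite ?tZ ?tX.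
- by have [-> _ _] := ef (w j) i.
- by rewrite phi_skew; have [_ _ ->] := ef i (w j); rewrite eq_sym far // oppr0.
- by have [_ _ ->] := ef (w j) i; rewrite far.
- by have [_ -> _] := ef (w j) i.
Qed.

(** The pairs of index at least [k] are orthogonal to [tau(H)], so they lift into [N(H)], where they
    play the standard generators of the smaller Pauli group. *)
Lemma adapted_stabilised_action (e f : 'I_n -> F) a :
    symplectic_from 0 e f -> adapted (tau_group H) k 0 e f a ->
  exists (s : {morphism ('N(H) / H)%g >-> Q})
         (U : 'Hom(subvs_of (fixV H), qudits C d (n - k))),
  [/\ isom ('N(H) / H)%g [set: Q] s, unitary_iso U
    & forall (x : coset_of H) (v : subvs_of (fixV H)),
        (x \in 'N(H) / H)%g -> U (quot_act x v) = pauli_op (s x) (U v)].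
Proof.
move=> ef efa; pose up (r : 'I_(n - k)) : 'I_n := cast_ord (subnKC le_kn) (rshift k r).
have up_ge r : (k <= up r)%N by exact: leq_addr.
have up_inj : injective up by move=> r s /cast_ord_inj/rshift_inj.
have upP (i : 'I_n) : (k <= i)%N -> exists r, i = up r.
  move=> ki; have lt_i : (i - k < n - k)%N by rewrite ltn_sub2r // (leq_ltn_trans ki).
  by exists (Ordinal lt_i); apply: val_inj; rewrite /= subnKC.
have efL r x : x \in tau_group H -> phi x (e (up r)) = 0 /\ phi x (f (up r)) = 0.
  by move=> xH; have := efa (up r) (leq0n _); rewrite ltnNge up_ge; apply.
have lift_ex (u : 'I_n -> F) : (forall r x, x \in tau_group H -> phi x (u (up r)) = 0) ->
  exists g : 'I_(n - k) -> P, forall r,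
    [/\ tau (g r) = u (up r), (g r ^+ d = 1)%g & g r \in 'N(H)%g].
  move=> uL; suff ex r : exists g, [/\ tau g = u (up r), (g ^+ d = 1)%g & g \in 'N(H)%g].
    by have [g gP] := fin_all_exists ex; exists g.
  have [||g [gu gd _]] := lift_of_order_d (u := u (up r)) (b := d) sfH _ _.
  - exact: dvdnn.
  - by rewrite mulrn_row //; exact: (group1 (tau_group H)).
  exists g; split=> //; apply/(normaliserP sfH) => x xH.
  by rewrite gu phi_skew uL ?oppr0.
have [r x xH|zl zlP] := lift_ex e; first by have [] := efL r x xH.
have [r x xH|xl xlP] := lift_ex f; first by have [] := efL r x xH.
have tz r : tau (zl r) = e (up r) by have [] := zlP r.
have tx r : tau (xl r) = f (up r) by have [] := xlP r.
have zlN r : zl r \in 'N(H)%g by have [] := zlP r.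
have xlN r : xl r \in 'N(H)%g by have [] := xlP r.
have zl_d r : (zl r ^+ d = 1)%g by have [] := zlP r.
have xl_d r : (xl r ^+ d = 1)%g by have [] := xlP r.
have zxl r s : [/\ phi (tau (zl r)) (tau (zl s)) = 0,
    phi (tau (xl r)) (tau (xl s)) = 0 & phi (tau (zl r)) (tau (xl s)) = (r == s)%:R].
  by rewrite !tz !tx -(inj_eq up_inj); exact: ef.
have span g : g \in 'N(H)%g -> exists b t : 'rV[Zmod d]_(n - k),
    tau g - \sum_r b 0 r *: tau (zl r) - \sum_r t 0 r *: tau (xl r) \in tau_set H.
  (* These are the coefficients of the symplectic expansion. The remainder is orthogonal to [tau(H)]
     and to the upper pairs, so it lies in [tau(H)]. *)
  move=> gN; exists (\row_r phi (tau g) (tau (xl r))), (\row_r - phi (tau g) (tau (zl r))).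
  have orth r x : x \in tau_set H -> phi (tau (zl r)) x = 0 /\ phi (tau (xl r)) x = 0.
    by move=> xH; rewrite !(normaliserP sfH _ _ x xH).
  apply: (adapted_lagrangian d_gt0 ef efa) => [x xH|].
    rewrite !phiDl !phiNl !phi_suml (normaliserP sfH _ gN x xH) !big1 ?subrr // => r _;
      by rewrite phiZl ?(orth r x xH).1 ?(orth r x xH).2 mulr0.
  apply/perpP => _ /upP[r ->]; rewrite -tz -tx !phiDl !phiNl !phi_suml; split.
    rewrite big1 ?subr0 => [|s _]; last by rewrite phiZl; have [-> _ _] := zxl s r; rewrite mulr0.
    rewrite (bigD1 r) //= big1 ?addr0 => [|s /negPf sr]; rewrite phiZl (phi_skew (tau (xl _))).
      by have [_ _ ->] := zxl r r; rewrite eqxx mxE mulrNN mulr1 subrr.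
    by have [_ _ ->] := zxl r s; rewrite eq_sym sr oppr0 mulr0.
  rewrite [X in _ - _ - X]big1 ?subr0 => [|s _]; last first.
    by rewrite phiZl; have [_ -> _] := zxl s r; rewrite mulr0.
  rewrite (bigD1 r) //= big1 ?addr0 => [|s /negPf sr]; rewrite phiZl.
    by have [_ _ ->] := zxl r r; rewrite eqxx mxE mulr1 subrr.
  by have [_ _ ->] := zxl s r; rewrite sr mulr0.
have [v0 [v0_norm v0H v0z]] := stabilised_vector sfH zlN xlN zl_d zxl.
exact: (stabilised_action sfH zlN xlN zl_d xl_d zxl span v0_norm v0H v0z).
Qed.

End ShiftedFreeQuotient.

Local Open Scope group_scope.

Theorem theorem3 (R : realType) (d n : nat) (d_gt0 : (0 < d)%N) (n_gt0 : (0 < n)%N)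
    (zeta : R[i]) (zetaP : (dbar d).-primitive_root zeta)
    (H : {group pauli zetaP n}) (abH : abelian H) (sfH : scalar_free H) :
  ((exists k : nat, (k <= n)%N /\
      'N(H) / H \isog [set: pauli zetaP (n - k)])
   <-> shifted_free H)
  /\
  (forall k : nat, (k <= n)%N ->
     'N(H) / H \isog [set: pauli zetaP (n - k)] ->
     exists (f : {morphism 'N(H) / H >-> pauli zetaP (n - k)})
            (U : 'Hom(subvs_of (fixV H), qudits R[i] d (n - k))),
       [/\ isom ('N(H) / H) [set: pauli zetaP (n - k)] f,
           unitary_iso U
         & forall (x : coset_of H) (v : subvs_of (fixV H)),
             x \in 'N(H) / H -> U (quot_act x v) = pauli_op (f x) (U v)]).
Proof.
split=> [|k le_kn iso]; last first.
  (* The given isomorphism serves to produce an adapted basis; the morphism and the unitary map are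
     then built from that basis. *)
  have [e [f [a [ef efa]]]] := quotient_pauli_adapted_basis le_kn abH sfH iso.
  exact: adapted_stabilised_action ef efa.
split=> [[k [le_kn iso]]|[k [le_kn [H' [_ _ _ shift]]]]].
  by exists k, le_kn; exact: quotient_pauli_is_shift.
have [e [f [a [ef efa]]]] := is_shift_adapted shift.
have [f0 [U [/isom_isog isoH _ _]]] := adapted_stabilised_action le_kn sfH ef efa.
by exists k; split=> //; exact: isoH.
Qed.
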